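(* Let $\lambda(x,\xi,t)$ be a uniform scattering frame (for the hard-sphere Boltzmann collision operator $Q$) with isotropic radius $\alpha$, and let $\|\cdot\|_O$, $\|\cdot\|_S$, $S(C)$ be the observer's norm, scattering norm and scattering spaces associated to $\lambda$. Let $0<N<\alpha$. (1) For any initial value $f_0$ (with finite mass, energy and momentum) such that $f_0(x-t\xi,\xi)\in S(\tfrac12N)$, there exists a unique uniform scattering solution $f\in S(N)$ of the Boltzmann equation $\partial_t f+\xi\cdot\nabla_x f=Q(f,f)$, $f(x,\xi,0)=f_0(x,\xi)$, and it scatters uniformly to a unique solution $f_\infty\in S(N)$ of the linear transport equation: $$\lim_{t\to\infty}\big\|f(x+t\xi,\xi,t)-f_\infty(x,\xi,0)\big\|_O=0.$$ (2) Conversely, for any solution $f_\infty\in S(\tfrac12N)$ of the linear transport equation there exists a unique uniform scattering solution $u_\infty\in S(N)$ of the Boltzmann equation that scatters uniformly to $f_\infty$: $$\lim_{t\to\infty}\big\|u_\infty(x+t\xi,\xi,t)-f_\infty(x,\xi,0)\big\|_O=0.$$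
   Context: Here $x,\xi\in\mathbb{R}^n$, $t\in[0,\infty)$, and the linear transport equation is $\partial_t g+\xi\cdot\nabla_x g=0$, i.e. $g(x+t\xi,\xi,t)=g(x,\xi,0)$. The Boltzmann equation is equivalently understood along characteristics: $f(x+t\xi,\xi,t)=f_0(x,\xi)+\int_0^tQ(f,f)(x+s\xi,\xi,s)\,ds$. Collision operator (hard spheres): for $\mathbf n\in S^{n-1}$ put $\xi'=\xi-(\mathbf n\cdot(\xi-\xi_* ))\mathbf n$, $\xi'_*=\xi_*+(\mathbf n\cdot(\xi-\xi_* ))\mathbf n$, and $f=f(x,\xi,t)$, $f_*=f(x,\xi_*,t)$, $f'=f(x,\xi',t)$, $f'_*=f(x,\xi'_*,t)$ (similarly for $g$). Then $$Q^+(f,g)=\tfrac12\int_{\mathbb{R}^n}\int_{S^{n-1}}(f'g'_*+g'f'_* )\,|\mathbf n\cdot(\xi'-\xi'_* )|\,d\mathbf n\,d\xi_*,$$ $$Q^-(f,g)=\tfrac12\int_{\mathbb{R}^n}\int_{S^{n-1}}(f_*g+g_*f)\,|\mathbf n\cdot(\xi-\xi_* )|\,d\mathbf n\,d\xi_*,$$ and $Q(f,g)=Q^+(f,g)-Q^-(f,g)$. Uniform scattering frame: a positive solution $\lambda(x,\xi,t)$ of the linear transport equation such that $$\sup_{x,\xi}\frac{1}{\lambda(x,\xi,0)}\int_0^\infty Q^+(\lambda,\lambda)(x+t\xi,\xi,t)\,dt+\sup_{x,\xi}\frac{1}{\lambda(x,\xi,0)}\int_0^\infty Q^-(\lambda,\lambda)(x+t\xi,\xi,t)\,dt<\infty$$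 and $$\lim_{z\to\infty}\Big(\sup_{x,\xi}\frac{1}{\lambda(x,\xi,0)}\int_z^\infty Q^+(\lambda,\lambda)(x+t\xi,\xi,t)\,dt+\sup_{x,\xi}\frac{1}{\lambda(x,\xi,0)}\int_z^\infty Q^-(\lambda,\lambda)(x+t\xi,\xi,t)\,dt\Big)=0.$$ Isotropic radius: $\alpha$ is defined by $$0<\frac1{2\alpha}=\sup_{x,\xi}\frac{1}{\lambda(x,\xi,0)}\int_0^\infty Q^+(\lambda,\lambda)(x+t\xi,\xi,t)\,dt+\sup_{x,\xi}\frac{1}{\lambda(x,\xi,0)}\int_0^\infty Q^-(\lambda,\lambda)(x+t\xi,\xi,t)\,dt<\infty.$$ Norms associated to $\lambda$: $\|f(x,\xi,t)\|_O=\sup_{x,\xi}\frac{|f(x,\xi,t)|}{\lambda(x,\xi,0)}$ (at fixed $t$), $\|f\|_S=\sup_{x,\xi,t}\frac{|f(x,\xi,t)|}{\lambda(x,\xi,t)}=\sup_t\|f(x+t\xi,\xi,t)\|_O$; $f\in S(C)$ if and only if $\|f\|_S\le C$. Uniform scattering solution: a solution $f$ of the Boltzmann equation with $\|f(x,\xi,0)\|_O+\big\|\int_0^\infty|Q(f,f)(x+t\xi,\xi,t)|\,dt\big\|_O<\infty$ and $\lim_{z\to\infty}\big\|\int_z^\infty|Q(f,f)(x+t\xi,\xi,t)|\,dt\big\|_O=0$. Finite mass, energy and momentum of $f_0$ means that the integrals over $\mathbb{R}^n\times\mathbb{R}^n$ of $f_0$, $f_0|\xi|^2$ and $f_0\xi$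 are convergent. *)

(* Defs.v *)
From HB Require Import structures.
From mathcomp Require Import all_boot all_order all_algebra.
From mathcomp Require Import all_classical all_reals all_analysis.
From mathcomp Require Import measurable_realfun.

Set Implicit Arguments.
Unset Strict Implicit.
Unset Printing Implicit Defensive.

Import Order.TTheory GRing.Theory Num.Theory.
Import numFieldNormedType.Exports.

Local Open Scope classical_set_scope.
Local Open Scope ring_scope.

(* Row vectors carry the sigma-algebra generated by the coordinates, i.e. the
   Borel sets when T is the real line. *)
Definition measure_row_display : measure_display -> measure_display.
Proof. exact. Qed.

Section measurable_row.
Context {d} {T : sigmaRingType d}.
Variable n : nat.

Let coord : 'I_n -> 'rV[T]_n -> T := fun i v => v ord0 i.

Let row_set0 : g_sigma_preimage coord set0.
Proof. exact: sigma_algebra0. Qed.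

Let row_setC A : g_sigma_preimage coord A -> g_sigma_preimage coord (~` A).
Proof. exact: sigma_algebraC. Qed.

Let row_bigcup (F : _^nat) : (forall i, g_sigma_preimage coord (F i)) ->
  g_sigma_preimage coord (\bigcup_i (F i)).
Proof. exact: sigma_algebra_bigcup. Qed.

HB.instance Definition _ := @isMeasurable.Build (measure_row_display d)
  ('rV[T]_n) (g_sigma_preimage coord) row_set0 row_setC row_bigcup.

End measurable_row.

Lemma measurable_coord d (T : sigmaRingType d) n (i : 'I_n) :
  measurable_fun [set: 'rV[T]_n] (fun v : 'rV[T]_n => v ord0 i).
Proof.
move=> _ Y mY; rewrite setTI; apply: sub_sigma_algebra => /=.
rewrite -bigcup_seq/=; exists i => /=; first by rewrite mem_index_enum.
by exists Y => //; rewrite setTI.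
Qed.

Lemma measurable_fun_rowP d1 d2 (T1 : measurableType d1)
    (T2 : measurableType d2) n (f : T1 -> 'rV[T2]_n) :
  measurable_fun [set: T1] f <->
  forall i, measurable_fun [set: T1] (fun x => f x ord0 i).
Proof.
pose c i (v : 'rV[T2]_n) := v ord0 i.
apply: (@iff_trans _ (g_sigma_preimage (fun i => c i \o f) `<=` measurable)).
  rewrite g_sigma_preimage_comp; split=> [mf A [/= C preC <-]|prefS].
    exact: mf.
  by move=> _ A mA; apply: prefS; exists A.
split=> [cf i|mf].
- move=> _ A mA; apply: cf; apply: sub_sigma_algebra.
  rewrite -bigcup_seq/=; exists i => /=; first by rewrite mem_index_enum.
  by exists A.
- apply: smallest_sub; first exact: sigma_algebra_measurable.
  rewrite -bigcup_seq/=; apply: bigcup_sub => i Ii.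
  by move=> A [B mB <-]; exact: mf.
Qed.


Lemma product_measure_sigma_finite d1 d2 (T1 : measurableType d1)
    (T2 : measurableType d2) (R : realType)
    (m1 : {sigma_finite_measure set T1 -> \bar R})
    (m2 : {sigma_finite_measure set T2 -> \bar R}) :
  sigma_finite setT (m1 \x m2)%E.
Proof.
have /sigma_finiteP[F [TF ndF Foo]] := sigma_finiteT m1.
have /sigma_finiteP[G [TG ndG Goo]] := sigma_finiteT m2.
exists (fun n => F n `*` G n).
  rewrite -setXTT TF TG predeqE => -[x y]; split.
    move=> [/= [n _ Fnx] [k _ Gky]]; exists (maxn n k) => //; split.
    - by move: x Fnx; exact/subsetPset/ndF/leq_maxl.
    - by move: y Gky; exact/subsetPset/ndG/leq_maxr.
  by move=> [n _ []/= ? ?]; split; exists n.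
move=> k; have [? ?] := Foo k; have [? ?] := Goo k.
split; first exact: measurableX.
by rewrite product_measure1E// lte_mul_pinfty// ge0_fin_numE.
Qed.

Section lebesgue_row.
Context {R : realType}.
Local Open Scope ereal_scope.

Definition row_cons n (p : measurableTypeR R * 'rV[R]_n) : 'rV[R]_n.+1 :=
  row_mx ((p.1 : R)%:M : 'rV[R]_1) p.2.

Definition row_uncons n (v : 'rV[R]_n.+1) : measurableTypeR R * 'rV[R]_n :=
  (v ord0 ord0, \row_j v ord0 (lift ord0 j)).

Lemma row_cons0 n p : @row_cons n p ord0 ord0 = p.1.
Proof.
rewrite /row_cons (_ : ord0 = lshift n (ord0 : 'I_1)); last exact/val_inj.
by rewrite (@row_mxEl _ 1 1 n) mxE eqxx mulr1n.
Qed.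

Lemma row_consS n p (j : 'I_n) : row_cons p ord0 (lift ord0 j) = p.2 ord0 j.
Proof.
rewrite /row_cons (_ : lift ord0 j = rshift 1 j); last exact/val_inj.
by rewrite (@row_mxEr _ 1 1 n).
Qed.

Lemma row_consK n : cancel (@row_cons n) (@row_uncons n).
Proof.
move=> p; rewrite /row_uncons row_cons0 [RHS]surjective_pairing; congr pair.
by apply/rowP => j; rewrite mxE row_consS.
Qed.

Lemma row_unconsK n : cancel (@row_uncons n) (@row_cons n).
Proof.
move=> v; apply/rowP => i; case: (unliftP ord0 i) => [j ->|->].
  by rewrite row_consS mxE.
by rewrite row_cons0.
Qed.

Lemma measurable_row_cons n : measurable_fun setT (@row_cons n).
Proof.
apply/measurable_fun_rowP => i; case: (unliftP ord0 i) => [j ->|->].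
  under eq_fun do rewrite row_consS.
  apply: (measurableT_comp (measurable_coord j)).
  exact: measurable_snd.
under eq_fun do rewrite row_cons0.
exact: measurable_fst.
Qed.

Lemma measurable_row_uncons n : measurable_fun setT (@row_uncons n).
Proof.
apply: measurable_fun_pair; first exact: measurable_coord.
apply/measurable_fun_rowP => i; under eq_fun do rewrite mxE.
exact: measurable_coord.
Qed.

Definition lebesgue_row_step n (mu : {sigma_finite_measure set 'rV[R]_n -> \bar R})
  : set 'rV[R]_n.+1 -> \bar R :=
  fun A => (lebesgue_measure \x mu) (@row_cons n @^-1` A).

Section step.
Variables (n : nat) (mu : {sigma_finite_measure set 'rV[R]_n -> \bar R}).

Let step0 : lebesgue_row_step mu set0 = 0.
Proof. by rewrite /lebesgue_row_step preimage_set0 measure0. Qed.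

Let step_ge0 A : 0 <= lebesgue_row_step mu A.
Proof. exact: measure_ge0. Qed.

Let step_sigma_additive : semi_sigma_additive (lebesgue_row_step mu).
Proof.
move=> F mF tF mUF; rewrite /lebesgue_row_step preimage_bigcup.
have mcons A : measurable A -> measurable (@row_cons n @^-1` A).
  by move=> mA; rewrite -[X in measurable X]setTI; exact: measurable_row_cons.
apply: measure_semi_sigma_additive => [i||]; first exact: mcons.
  apply/trivIsetP => /= i j _ _ ij; rewrite -preimage_setI.
  by move/trivIsetP : tF => /(_ _ _ _ _ ij) ->//; rewrite preimage_set0.
by rewrite -preimage_bigcup; exact: mcons.
Qed.

HB.instance Definition _ := isMeasure.Build _ _ _ (lebesgue_row_step mu)
  step0 step_ge0 step_sigma_additive.

Let step_sigma_finite : sigma_finite setT (lebesgue_row_step mu).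
Proof.
have [F TF Foo] := product_measure_sigma_finite lebesgue_measure mu.
exists (fun k => @row_uncons n @^-1` F k).
  by rewrite -preimage_bigcup -TF preimage_setT.
move=> k; have [mF Fk] := Foo k; split.
  by rewrite -[X in measurable X]setTI; exact: measurable_row_uncons.
rewrite /lebesgue_row_step -comp_preimage.
rewrite (_ : _ \o _ = id) ?preimage_id//.
by apply/funext => p /=; rewrite row_consK.
Qed.

HB.instance Definition _ := Measure_isSigmaFinite.Build _ _ _
  (lebesgue_row_step mu) step_sigma_finite.

End step.

Fixpoint lebesgue_row n : {sigma_finite_measure set 'rV[R]_n -> \bar R} :=
  if n isn't m.+1 then \d_(0%R : 'rV[R]_0) else lebesgue_row_step (lebesgue_row m).

Lemma lebesgue_row_box n (a b : R) : (a <= b)%R ->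
  lebesgue_row n [set v | forall i, a <= v ord0 i <= b]%R = ((b - a) ^+ n)%:E.
Proof.
move=> ab; elim: n => [|n IHn].
  by rewrite /= diracE mem_set// => -[].
rewrite /= /lebesgue_row_step.
set B := [set v : 'rV[R]_n | forall i, a <= v ord0 i <= b]%R in IHn.
have -> : @row_cons n @^-1` [set v | forall i, a <= v ord0 i <= b]%R =
    `[a, b]%classic `*` B.
  apply/seteqP; split => p /=.
    move=> pab; split; first by rewrite /= in_itv/= -row_cons0 pab.
    by move=> i; rewrite -row_consS pab.
  move=> [p1 p2] i; case: (unliftP ord0 i) => [j ->|->].
    by rewrite row_consS p2.
  by rewrite row_cons0; move: p1; rewrite /= in_itv.
have mB : measurable B.
  rewrite (_ : B = \bigcap_(i in [set: 'I_n])
     ((fun v : 'rV[R]_n => v ord0 i) @^-1` `[a, b]%classic)).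
    apply: fin_bigcap_measurable; first exact: finite_finset.
    move=> i _; rewrite -[X in measurable X]setTI.
    exact: measurable_coord.
  apply/seteqP; split => v /=.
    by move=> vB i _; rewrite /= in_itv/= vB.
  by move=> vB i; have := vB i I; rewrite /= in_itv.
rewrite product_measure1E//= IHn lebesgue_measure_itv/= lte_fin.
case: ltgtP ab => // [ab|->] _; first by rewrite exprS EFinM.
by rewrite subrr exprS mul0r mul0e.
Qed.

End lebesgue_row.

Section euclidean.
Context {R : realType} {n : nat}.
Implicit Types u v : 'rV[R]_n.

Definition dot u v : R := \sum_i u ord0 i * v ord0 i.

Definition enorm u : R := Num.sqrt (dot u u).

Definition normalize u : 'rV[R]_n := (enorm u)^-1 *: u.

Lemma dot_ge0 u : 0 <= dot u u.
Proof. by apply: sumr_ge0 => i _; rewrite -expr2 sqr_ge0. Qed.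

Lemma measurable_dot : measurable_fun setT (fun u => dot u u).
Proof.
apply: measurable_sum => i.
exact: measurable_funM (measurable_coord i) (measurable_coord i).
Qed.

Lemma measurable_enorm : measurable_fun setT enorm.
Proof.
have ms : measurable_fun [set: R] (@Num.sqrt R).
  by apply: continuous_measurable_fun; exact: sqrt_continuous.
exact: (measurableT_comp ms measurable_dot).
Qed.

Lemma measurable_normalize : measurable_fun setT normalize.
Proof.
apply/measurable_fun_rowP => i; under eq_fun do rewrite mxE.
apply: measurable_funM (measurable_coord i).
under eq_fun do rewrite -powR_inv1 ?sqrtr_ge0//.
exact: (measurableT_comp (measurable_powR _) measurable_enorm).
Qed.

Lemma coord_enorm u i : `|u ord0 i| <= enorm u.
Proof.
rewrite -sqrtr_sqr ler_wsqrtr// /dot (bigD1 i)//= -expr2 lerDl sumr_ge0// => j _.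
by rewrite -expr2 sqr_ge0.
Qed.

Definition punctured_ball : set 'rV[R]_n := [set y | 0 < enorm y <= 1].

Lemma measurable_punctured_ball : measurable punctured_ball.
Proof.
rewrite (_ : punctured_ball = enorm @^-1` `]0, 1]%classic).
  by rewrite -[X in measurable X]setTI; exact: measurable_enorm.
by apply/seteqP; split => y; rewrite /punctured_ball /= in_itv.
Qed.

End euclidean.

Section sphere_measure.
Context {R : realType}.
Variable n : nat.
Local Open Scope ereal_scope.

(* Surface measure of the Euclidean unit sphere of R^n, as a measure on R^n
   carried by the sphere: n times the volume of the cone over A. For n = 1 it
   is the counting measure on {-1, 1}. *)
Definition sphere_measure (A : set 'rV[R]_n) : \bar R :=
  n%:R%:E * lebesgue_row n (normalize @^-1` A `&` punctured_ball).

Let cone_measurable (A : set 'rV[R]_n) : measurable A ->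
  measurable (normalize @^-1` A `&` @punctured_ball R n).
Proof.
move=> mA; apply: measurableI; last exact: measurable_punctured_ball.
by rewrite -[X in measurable X]setTI; exact: measurable_normalize.
Qed.

Let sphere0 : sphere_measure set0 = 0.
Proof. by rewrite /sphere_measure preimage_set0 set0I measure0 mule0. Qed.

Let sphere_ge0 A : 0 <= sphere_measure A.
Proof. by rewrite mule_ge0. Qed.

Let sphere_sigma_additive : semi_sigma_additive sphere_measure.
Proof.
move=> F mF tF mUF; rewrite /sphere_measure preimage_bigcup setI_bigcupl.
rewrite [X in X @ _ --> _](_ : _ = (fun k => n%:R%:E * \sum_(0 <= i < k)
    lebesgue_row n (normalize @^-1` F i `&` @punctured_ball R n))); last first.
  by apply/funext => k; rewrite ge0_sume_distrr.
apply: cvgeZl => //; apply: measure_semi_sigma_additive.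
- by move=> i; exact: cone_measurable.
- apply/trivIsetP => /= i j _ _ ij; rewrite setIACA -preimage_setI.
  by move/trivIsetP : tF => /(_ _ _ _ _ ij) ->//; rewrite preimage_set0 set0I.
- by rewrite -setI_bigcupl -preimage_bigcup; exact: cone_measurable.
Qed.

HB.instance Definition _ := isMeasure.Build _ _ _ sphere_measure
  sphere0 sphere_ge0 sphere_sigma_additive.

Let sphere_fin : fin_num_fun sphere_measure.
Proof.
move=> A mA; rewrite /sphere_measure fin_numM//.
rewrite ge0_fin_numE ?measure_ge0//.
apply: (@le_lt_trans _ _ (lebesgue_row n
    [set v : 'rV[R]_n | forall i, -1 <= v ord0 i <= 1]%R)).
  apply: le_measure; rewrite ?inE.
  - exact: cone_measurable.
  - rewrite (_ : mkset _ = \bigcap_(i in [set: 'I_n])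
       ((fun v : 'rV[R]_n => v ord0 i) @^-1` `[(-1)%R, 1%R]%classic)).
      apply: fin_bigcap_measurable; first exact: finite_finset.
      move=> i _; rewrite -[X in measurable X]setTI.
      exact: measurable_coord.
    apply/seteqP; split => v /=.
      by move=> vB i _; rewrite /= in_itv/= vB.
    by move=> vB i; have := vB i I; rewrite /= in_itv.
  - move=> v [_ /andP[_ v1]] i; rewrite -ler_norml.
    exact: le_trans (coord_enorm v i) v1.
by rewrite lebesgue_row_box ?ltry// lerN10.
Qed.

HB.instance Definition _ := Measure_isFinite.Build _ _ _ sphere_measure
  sphere_fin.

(* d xi_* d n: the first component is the velocity xi_*, the second one the
   direction n. *)
Definition collision_measure : set ('rV[R]_n * 'rV[R]_n) -> \bar R :=
  lebesgue_row n \x sphere_measure.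

HB.instance Definition _ := Measure.on collision_measure.

HB.instance Definition _ := Measure_isSigmaFinite.Build _ _ _ collision_measure
  (product_measure_sigma_finite (lebesgue_row n) sphere_measure).

End sphere_measure.

Arguments sphere_measure {R} n A.
Arguments collision_measure {R} n _.

Section boltzmann.
Context {R : realType} {n : nat}.
Local Notation V := 'rV[R]_n.

(* A function of (x, xi, t). Time ranges over [0, +oo[: no definition below
   depends on values at negative times. *)
Definition phase_fun := V -> V -> R -> R.

Implicit Types (f g finf lambda : phase_fun) (x xi : V) (t : R).

Definition measurable_phase_fun f :=
  measurable_fun ([set: V * V] `*` (`[0, +oo[%classic : set (measurableTypeR R)))
    (fun p => f p.1.1 p.1.2 p.2).

Definition along_characteristic (S : Type) (h : V -> V -> R -> S) x xi t : S :=
  h (x + t *: xi) xi t.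

Definition linear_transport_solution g :=
  measurable_phase_fun g /\
  forall x xi t, 0 <= t -> g (x + t *: xi) xi t = g x xi 0.

Definition post_collision (w xi xi_ : V) : V * V :=
  (xi - dot w (xi - xi_) *: w, xi_ + dot w (xi - xi_) *: w).

(* The integrals below are extended-real Lebesgue integrals of signed
   functions: Q f g x xi t is finite only if both the gain and the loss
   integrals converge absolutely. *)
Definition Qplus f g x xi t : \bar R :=
  ((2^-1)%:E * \int[collision_measure n]_p
     let xi_ := p.1 in let w := p.2 in
     let xi' := (post_collision w xi xi_).1 in
     let xi'_ := (post_collision w xi xi_).2 in
     ((f x xi' t * g x xi'_ t + g x xi' t * f x xi'_ t)
        * `|dot w (xi' - xi'_)|)%:E)%E.

Definition Qminus f g x xi t : \bar R :=
  ((2^-1)%:E * \int[collision_measure n]_p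
     let xi_ := p.1 in let w := p.2 in
     ((f x xi_ t * g x xi t + g x xi_ t * f x xi t)
        * `|dot w (xi - xi_)|)%:E)%E.

Definition Q f g x xi t : \bar R := (Qplus f g x xi t - Qminus f g x xi t)%E.

(* Boltzmann equation along characteristics. Integrability of Q(f, f) on [0, t]
   is the convergence of the integral in the equation. *)
Definition boltzmann_solution f :=
  measurable_phase_fun f /\
  forall x xi t, 0 <= t ->
    lebesgue_measure.-integrable (`[0, t]%classic : set (measurableTypeR R))
      (along_characteristic (Q f f) x xi) /\
    (f (x + t *: xi) xi t)%:E = ((f x xi 0)%:E +
      \int[lebesgue_measure]_(s in `[0%R, t]) along_characteristic (Q f f) x xi s)%E.

Definition weighted_sup lambda (h : V -> V -> \bar R) : \bar R :=
  ereal_sup [set (((lambda p.1 p.2 0)^-1)%:E * h p.1 p.2)%E | p in [set: V * V]].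

Definition observer_norm lambda (h : V -> V -> \bar R) : \bar R :=
  weighted_sup lambda (fun x xi => `|h x xi|%E).

Definition scattering_norm lambda f : \bar R :=
  ereal_sup [set (`|f p.1.1 p.1.2 p.2| / lambda p.1.1 p.1.2 p.2)%:E |
    p in [set p : V * V * R | 0 <= p.2]].

Definition scattering_space lambda (C : R) f :=
  (scattering_norm lambda f <= C%:E)%E.

Definition tail_integral (h : V -> V -> R -> \bar R) (z : R) x xi : \bar R :=
  (\int[lebesgue_measure]_(t in `[z, +oo[) along_characteristic h x xi t)%E.

Definition scattering_tail lambda (z : R) : \bar R :=
  (weighted_sup lambda (tail_integral (Qplus lambda lambda) z) +
   weighted_sup lambda (tail_integral (Qminus lambda lambda) z))%E.

Definition uniform_scattering_frame lambda :=
  [/\ linear_transport_solution lambda,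
      forall x xi t, 0 <= t -> 0 < lambda x xi t,
      (scattering_tail lambda 0 < +oo)%E &
      scattering_tail lambda z @[z --> +oo%R] --> 0%E].

Definition isotropic_radius lambda (alpha : R) :=
  0 < (2 * alpha)^-1 /\ ((2 * alpha)^-1)%:E = scattering_tail lambda 0.

Definition uniform_scattering_solution lambda f :=
  let absQ x xi t := `|Q f f x xi t|%E in
  [/\ boltzmann_solution f,
      (observer_norm lambda (fun x xi => (f x xi 0)%:E) +
       observer_norm lambda (tail_integral absQ 0) < +oo)%E &
      observer_norm lambda (tail_integral absQ z) @[z --> +oo%R] --> 0%E].

Definition scatters_uniformly_to lambda f finf :=
  observer_norm lambda
    (fun x xi => (f (x + t *: xi) xi t - finf x xi 0)%:E) @[t --> +oo%R] --> 0%E.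

Definition finite_mass_energy_momentum (f0 : V -> V -> R) :=
  let mu := (lebesgue_row n \x lebesgue_row n)%E in
  [/\ mu.-integrable setT (fun p => (f0 p.1 p.2)%:E),
      mu.-integrable setT (fun p => (f0 p.1 p.2 * enorm p.2 ^+ 2)%:E) &
      forall i, mu.-integrable setT (fun p => (f0 p.1 p.2 * p.2 ord0 i)%:E)].

Definition free_flow (f0 : V -> V -> R) : phase_fun :=
  fun x xi t => f0 (x - t *: xi) xi.

Definition unique_phase_fun (P : phase_fun -> Prop) f :=
  P f /\ forall g, P g -> forall x xi t, 0 <= t -> g x xi t = f x xi t.

End boltzmann.

Arguments phase_fun : clear implicits.

(* Main.v *)
Require Import Defs.
From HB Require Import structures.
From mathcomp Require Import all_boot all_order all_algebra.
From mathcomp Require Import all_classical all_reals all_analysis.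
From mathcomp Require Import measurable_realfun.
From mathcomp Require Import ring lra.

(* Along characteristics the Boltzmann equation reads
     f(x + t xi, xi, t) = f_0(x, xi) + int_0^t Q(f, f)(x + s xi, xi, s) ds,
   and the solution scattering to f_oo is characterised by
     f(x + t xi, xi, t) = f_oo(x, xi, 0) - int_t^oo Q(f, f)(x + s xi, xi, s) ds.
   Both are fixed-point equations for
     f |-> h(x, xi) + int_0^oo k(t, s) Q(f, f)(x + s xi, xi, s) ds
   with a measurable kernel |k| <= 1. If |f|, |g| <= N lambda and
   |f - g| <= D lambda, then bilinearity gives
   |Q(f, f) - Q(g, g)| <= 2 N D (Q+ + Q-)(lambda, lambda), whose integral along
   a characteristic is at most N D lambda / alpha. The map is thus a contraction
   of ratio N / alpha < 1 of the scattering ball of radius N into itself, and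
   the tail condition on the frame turns the remainder int_t^oo Q(f, f) into
   uniform scattering. *)

Set Implicit Arguments.
Unset Strict Implicit.
Unset Printing Implicit Defensive.

Import Order.TTheory GRing.Theory Num.Theory.
Import numFieldNormedType.Exports.

Local Open Scope classical_set_scope.
Local Open Scope ring_scope.

(** * Measurability of the collision operator *)

(** The integrand is signed: it is extended by zero outside [D] x [A] and split into positive and
    negative parts, Tonelli is applied to each, and the difference of two measurable extended-real
    functions is measurable. No integrability enters. *)
Lemma measurable_parametric_integral d1 d2 (T1 : measurableType d1)
    (T2 : measurableType d2) (R : realType)
    (m2 : {sigma_finite_measure set T2 -> \bar R}) (D : set T1) (A : set T2)
    (F : T1 * T2 -> \bar R) :
  measurable D -> measurable A -> measurable_fun (D `*` A) F ->
  measurable_fun D (fun x => \int[m2]_(y in A) F (x, y))%E.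
Proof.
move=> mD mA mF; have mDA : measurable (D `*` A) by exact: measurableX.
pose G := F \_ (D `*` A).
have mG : measurable_fun setT G := (measurable_restrictT F mDA).1 mF.
apply: (eq_measurable_fun (fun x => \int[m2]_y G (x, y))%E) => [x|].
  rewrite inE => Dx; rewrite [RHS]integral_mkcond; apply: eq_integral => y _.
  rewrite /G !patchE; congr (if _ then _ else _).
  by apply/idP/idP; rewrite !inE; [case|split].
apply: measurable_funTS.
rewrite (_ : (fun x => _) = fun x =>
    (\int[m2]_y G^\+ (x, y) - \int[m2]_y G^\- (x, y))%E); last first.
  apply/funext => x; rewrite integralE; congr (_ - _)%E;
    by apply: eq_integral => y _; rewrite ?funeposE ?funenegE.
apply: emeasurable_funB.
  apply: (measurable_fun_fubini_tonelli_F (G^\+)%E) => //.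
  exact: measurable_funepos.
apply: (measurable_fun_fubini_tonelli_F (G^\-)%E) => //.
exact: measurable_funeneg.
Qed.

Lemma measurable_fun_pair_on d d1 d2 (T : measurableType d)
    (T1 : measurableType d1) (T2 : measurableType d2) (D : set T)
    (f : T -> T1) (g : T -> T2) :
  measurable D -> measurable_fun D f -> measurable_fun D g ->
  measurable_fun D (fun x => (f x, g x)).
Proof.
move=> mD /(measurable_restrictT _ mD) mf /(measurable_restrictT _ mD) mg.
apply: (eq_measurable_fun (fun x => ((f \_ D) x, (g \_ D) x))) => [x Dx|].
  by rewrite !patchE Dx.
by apply: measurable_funTS; exact: measurable_fun_pair.
Qed.

Section measurability.
Context {d} {X : measurableType d} {R : realType} {n : nat}.
Implicit Types (D : set X) (u v : X -> 'rV[R]_n) (a : X -> R).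

Lemma measurable_fun_row_on D u : measurable D ->
  (forall i, measurable_fun D (fun x => u x ord0 i)) -> measurable_fun D u.
Proof.
move=> mD mu; apply/(measurable_restrictT _ mD)/measurable_fun_rowP => i.
have /(measurable_restrictT _ mD) := mu i; apply: eq_measurable_fun => x _.
by rewrite !patchE; case: ifP => // _; rewrite mxE.
Qed.

Lemma measurable_fun_coord D u i : measurable_fun D u ->
  measurable_fun D (fun x => u x ord0 i).
Proof. exact: measurableT_comp (measurable_coord i). Qed.

Lemma measurable_fun_rowD D u v : measurable D ->
  measurable_fun D u -> measurable_fun D v ->
  measurable_fun D (fun x => u x + v x).
Proof.
move=> mD mu mv; apply: measurable_fun_row_on => // i.
under eq_fun do rewrite mxE.
by apply: measurable_funD; exact: measurable_fun_coord.
Qed.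

Lemma measurable_fun_rowZ D a u : measurable D ->
  measurable_fun D a -> measurable_fun D u ->
  measurable_fun D (fun x => a x *: u x).
Proof.
move=> mD ma mu; apply: measurable_fun_row_on => // i.
under eq_fun do rewrite mxE.
by apply: measurable_funM => //; exact: measurable_fun_coord.
Qed.

Lemma measurable_fun_rowB D u v : measurable D ->
  measurable_fun D u -> measurable_fun D v ->
  measurable_fun D (fun x => u x - v x).
Proof.
move=> mD mu mv; apply: measurable_fun_row_on => // i.
under eq_fun do rewrite !mxE.
by apply: measurable_funB; exact: measurable_fun_coord.
Qed.

Lemma measurable_fun_dot D u v : measurable D ->
  measurable_fun D u -> measurable_fun D v ->
  measurable_fun D (fun x => dot (u x) (v x)).
Proof.
move=> mD mu mv; apply: measurable_sum => i.
by apply: measurable_funM; exact: measurable_fun_coord.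
Qed.

(** Measurability of a phase function is known at nonnegative times only, whence the sign condition
    on [a] over [D]. *)
Lemma measurable_phase_fun_comp (f : phase_fun R n) D u v
    (a : X -> measurableTypeR R) : measurable_phase_fun f ->
  measurable D -> (forall x, D x -> 0 <= (a x : R)) ->
  measurable_fun D u -> measurable_fun D v -> measurable_fun D a ->
  measurable_fun D (fun x => f (u x) (v x) (a x)).
Proof.
move=> mf mD a0 mu mv ma.
pose F (p : ('rV[R]_n * 'rV[R]_n) * measurableTypeR R) : R := f p.1.1 p.1.2 p.2.
pose h x := ((u x, v x), a x).
apply: (measurable_comp _ _ mf (g := h)).
- by apply: measurableX => //; exact: measurable_itv.
- by move=> _ [x Dx <-]; split => //=; rewrite in_itv/= andbT a0.
- by apply: measurable_fun_pair_on => //; exact: measurable_fun_pair_on.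
Qed.
End measurability.

(** * Gain and loss integrands *)

Section collision_integrands.
Context {R : realType} {n : nat}.
Implicit Types (f g : phase_fun R n) (x xi : 'rV[R]_n) (t : R)
  (p : 'rV[R]_n * 'rV[R]_n).

(** The integrands of [Qplus] and [Qminus] are named so that bilinear estimates can be proved
    pointwise in the collision parameters and integrated afterwards. *)
Definition gain_integrand f g x xi t p : R :=
  let xi_ := p.1 in let w := p.2 in
  let xi' := (post_collision w xi xi_).1 in
  let xi'_ := (post_collision w xi xi_).2 in
  (f x xi' t * g x xi'_ t + g x xi' t * f x xi'_ t) * `|dot w (xi' - xi'_)|.

Definition loss_integrand f g x xi t p : R :=
  let xi_ := p.1 in let w := p.2 in
  (f x xi_ t * g x xi t + g x xi_ t * f x xi t) * `|dot w (xi - xi_)|.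

Lemma QplusE f g x xi t : Qplus f g x xi t =
  ((2^-1)%:E * \int[collision_measure n]_p (gain_integrand f g x xi t p)%:E)%E.
Proof. by []. Qed.

Lemma QminusE f g x xi t : Qminus f g x xi t =
  ((2^-1)%:E * \int[collision_measure n]_p (loss_integrand f g x xi t p)%:E)%E.
Proof. by []. Qed.

End collision_integrands.

Section collision_measurability.
Context {R : realType} {n : nat}.
Variables (f g : phase_fun R n).
Hypotheses (mf : measurable_phase_fun f) (mg : measurable_phase_fun g).

Section integrands.
Context {d} {X : measurableType d}.
Variables (D : set X) (u v xis w : X -> 'rV[R]_n) (a : X -> measurableTypeR R).
Hypotheses (mD : measurable D) (a0 : forall x, D x -> 0 <= (a x : R))
  (mu : measurable_fun D u) (mv : measurable_fun D v)
  (mxis : measurable_fun D xis) (mw : measurable_fun D w)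
  (ma : measurable_fun D a).

Lemma measurable_gain_integrand : measurable_fun D
  (fun x => gain_integrand f g (u x) (v x) (a x) (xis x, w x)).
Proof.
have mdot : measurable_fun D (fun x => dot (w x) (v x - xis x)).
  by apply: measurable_fun_dot => //; exact: measurable_fun_rowB.
have m1 : measurable_fun D (fun x => (post_collision (w x) (v x) (xis x)).1).
  by apply: measurable_fun_rowB => //; exact: measurable_fun_rowZ.
have m2 : measurable_fun D (fun x => (post_collision (w x) (v x) (xis x)).2).
  by apply: measurable_fun_rowD => //; exact: measurable_fun_rowZ.
apply: measurable_funM.
  by apply: measurable_funD; apply: measurable_funM;
    apply: measurable_phase_fun_comp.
apply: measurableT_comp => //.
by apply: measurable_fun_dot => //; exact: measurable_fun_rowB.
Qed.

Lemma measurable_loss_integrand : measurable_fun D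
  (fun x => loss_integrand f g (u x) (v x) (a x) (xis x, w x)).
Proof.
apply: measurable_funM.
  by apply: measurable_funD; apply: measurable_funM;
    apply: measurable_phase_fun_comp.
apply: measurableT_comp => //.
by apply: measurable_fun_dot => //; exact: measurable_fun_rowB.
Qed.

End integrands.

Lemma measurable_gain_integrand_pair x xi (t : R) : 0 <= t ->
  measurable_fun setT (gain_integrand f g x xi t).
Proof.
move=> t0; rewrite (_ : gain_integrand _ _ _ _ _ = fun p =>
  gain_integrand f g x xi t (p.1, p.2)); last by apply/funext => -[].
apply: (@measurable_gain_integrand _ _ setT (fun=> x) (fun=> xi) fst snd
  (fun=> t)) => //.
Qed.

Lemma measurable_loss_integrand_pair x xi (t : R) : 0 <= t ->
  measurable_fun setT (loss_integrand f g x xi t).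
Proof.
move=> t0; rewrite (_ : loss_integrand _ _ _ _ _ = fun p =>
  loss_integrand f g x xi t (p.1, p.2)); last by apply/funext => -[].
apply: (@measurable_loss_integrand _ _ setT (fun=> x) (fun=> xi) fst snd
  (fun=> t)) => //.
Qed.

Section operators.
Context {d} {X : measurableType d}.
Variables (D : set X) (u v : X -> 'rV[R]_n) (a : X -> measurableTypeR R).
Hypotheses (mD : measurable D) (a0 : forall x, D x -> 0 <= (a x : R))
  (mu : measurable_fun D u) (mv : measurable_fun D v) (ma : measurable_fun D a).

Let V := 'rV[R]_n.
Let E := D `*` [set: V * V].

Let mE : measurable E. Proof. exact: measurableX. Qed.

Let a0E q : E q -> 0 <= (a q.1 : R). Proof. by case=> /a0. Qed.

Let comp_fst d' (Y : measurableType d') (h : X -> Y) : measurable_fun D h ->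
  measurable_fun E (fun q => h q.1).
Proof.
move=> mh; apply: (measurable_comp mD _ mh (g := fst)).
- by move=> _ [q [Dq _] <-].
- by apply: measurable_funTS; exact: measurable_fst.
Qed.

Let comp_snd d' (Y : measurableType d') (h : V * V -> Y) :
  measurable_fun setT h -> measurable_fun E (fun q => h q.2).
Proof.
move=> mh; apply: measurable_funTS.
by apply: (measurableT_comp mh); exact: measurable_snd.
Qed.

Lemma measurable_Qplus : measurable_fun D (fun x => Qplus f g (u x) (v x) (a x)).
Proof.
apply: measurable_funeM.
apply: (@measurable_parametric_integral _ _ _ _ _ (collision_measure n) D setT
  (fun q => (gain_integrand f g (u q.1) (v q.1) (a q.1) (q.2.1, q.2.2))%:E)) => //.
apply/measurable_EFinP; apply: measurable_gain_integrand => //;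
  [exact: comp_fst|exact: comp_fst| | |exact: comp_fst].
- by apply: (comp_snd (h := fst)).
- by apply: (comp_snd (h := snd)).
Qed.

Lemma measurable_Qminus :
  measurable_fun D (fun x => Qminus f g (u x) (v x) (a x)).
Proof.
apply: measurable_funeM.
apply: (@measurable_parametric_integral _ _ _ _ _ (collision_measure n) D setT
  (fun q => (loss_integrand f g (u q.1) (v q.1) (a q.1) (q.2.1, q.2.2))%:E)) => //.
apply/measurable_EFinP; apply: measurable_loss_integrand => //;
  [exact: comp_fst|exact: comp_fst| | |exact: comp_fst].
- by apply: (comp_snd (h := fst)).
- by apply: (comp_snd (h := snd)).
Qed.

Lemma measurable_Q : measurable_fun D (fun x => Q f g (u x) (v x) (a x)).
Proof.
by apply: emeasurable_funB; [exact: measurable_Qplus|exact: measurable_Qminus].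
Qed.

End operators.
End collision_measurability.

(** * Bounds on the collision operator *)

Section domination.
Context {d} {T : measurableType d} {R : realType}.
Variables (mu : {measure set T -> \bar R}) (L : T -> R).
Hypotheses (mL : measurable_fun setT L) (L0 : forall x, 0 <= L x).
Implicit Types (F G : T -> R) (a c : R).

(** [L] may have an infinite integral here, so the estimate is available before any finiteness is
    known. *)
Lemma le_abse_integral_dominated F c : measurable_fun setT F -> 0 <= c ->
  (forall x, `|F x| <= c * L x) ->
  (`|\int[mu]_x (F x)%:E| <= c%:E * \int[mu]_x (L x)%:E)%E.
Proof.
move=> mF c0 FL.
have mEF : measurable_fun setT (EFin \o F) by exact/measurable_EFinP.
have mEL : measurable_fun setT (EFin \o L) by exact/measurable_EFinP.
apply: (le_trans (le_abse_integral mu measurableT mEF)).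
rewrite -ge0_integralZl_EFin//; last by move=> x _; rewrite lee_fin.
apply: ge0_le_integral => //.
- exact: measurableT_comp.
- exact: measurable_funeM.
- by move=> x _ /=; rewrite lee_fin.
Qed.

Lemma fin_num_integral_dominated F c : measurable_fun setT F ->
  (\int[mu]_x (L x)%:E < +oo)%E -> (forall x, `|F x| <= c * L x) ->
  (\int[mu]_x (F x)%:E \is a fin_num)%E.
Proof.
move=> mF Loo FL; rewrite fin_num_abs.
(* The sign of [c] is not given, so [c] is first replaced by its absolute value. *)
apply: (@le_lt_trans _ _ (`|c|%:E * \int[mu]_x (L x)%:E)%E).
  apply: le_abse_integral_dominated => // x.
  by rewrite (le_trans (FL x))// ler_wpM2r// ler_norm.
by rewrite lte_mul_pinfty//.
Qed.

(** The two constants have separate roles: [a] only makes [F] and [G] integrable, so that the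
    difference of the integrals is the integral of the difference, while [c] gives the size of the
    result. *)
Lemma le_abse_integralB_dominated F G a c : measurable_fun setT F ->
  measurable_fun setT G -> 0 <= c ->
  (forall x, `|F x| <= a * L x) -> (forall x, `|G x| <= a * L x) ->
  (forall x, `|F x - G x| <= c * L x) ->
  (\int[mu]_x (L x)%:E < +oo)%E ->
  (`|\int[mu]_x (F x)%:E - \int[mu]_x (G x)%:E| <=
    c%:E * \int[mu]_x (L x)%:E)%E.
Proof.
move=> mF mG c0 FL GL FGL Loo.
have iL : mu.-integrable setT (EFin \o L).
  apply/integrableP; split; first exact/measurable_EFinP.
  by under eq_integral do rewrite /= ger0_norm//.
have dom (H : T -> R) : measurable_fun setT H -> (forall x, `|H x| <= a * L x) ->
    mu.-integrable setT (EFin \o H).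
  move=> mH HL.
  apply: (le_integrable measurableT _ _ (integrableZl measurableT a iL)).
    exact/measurable_EFinP.
  by move=> x _ /=; rewrite lee_fin (le_trans (HL x))// ler_norm.
rewrite -integralB_EFin//; [|exact: dom|exact: dom].
under eq_integral do rewrite -EFinB.
apply: (@le_abse_integral_dominated (fun x => F x - G x)) => //.
exact: measurable_funB.
Qed.

End domination.

(** * Comparison of the collision operator with the collision rate of the frame *)

Section pointwise.
Context {R : realType} {n : nat}.
Implicit Types (f g lambda : phase_fun R n) (x xi : 'rV[R]_n) (t A D : R)
  (p : 'rV[R]_n * 'rV[R]_n).

(** This is membership in the scattering space without suprema or quotients, the form in which
    estimates can be multiplied and integrated. *)
Definition dominated lambda A f :=
  forall x xi t, 0 <= t -> `|f x xi t| <= A * lambda x xi t.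

Lemma scattering_spaceP lambda A f :
  (forall x xi t, 0 <= t -> 0 < lambda x xi t) ->
  scattering_space lambda A f <-> dominated lambda A f.
Proof.
move=> lambda_gt0; split=> [fA x xi t t0|fA].
  rewrite -ler_pdivrMr ?lambda_gt0// -lee_fin; apply: le_trans fA.
  by apply: ereal_sup_ubound; exists ((x, xi), t).
apply: ge_ereal_sup => _ [[[x xi] t] /= t0 <-].
by rewrite lee_fin ler_pdivrMr ?lambda_gt0// fA.
Qed.

Lemma ler_norm_mul_dominated (a b l m A : R) :
  `|a| <= A * l -> `|b| <= A * m -> `|a * b| <= A ^+ 2 * (l * m).
Proof.
move=> al bm; rewrite normrM expr2 mulrACA.
by apply: ler_pM.
Qed.

(** The splitting a b - c d = a (b - d) + (a - c) d shows that a product is Lipschitz with constant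
    2 A on the ball of radius A; this 2 A is the source of the contraction ratio. *)
Lemma ler_norm_mulB_dominated (a b c d l m A D : R) :
  `|a| <= A * l -> `|d| <= A * m -> `|a - c| <= D * l -> `|b - d| <= D * m ->
  `|a * b - c * d| <= 2 * A * D * (l * m).
Proof.
move=> al dm acl bdm.
have -> : a * b - c * d = a * (b - d) + (a - c) * d by ring.
have -> : 2 * A * D * (l * m) = A * l * (D * m) + D * l * (A * m) by ring.
by rewrite (le_trans (ler_normD _ _))// lerD// normrM ler_pM.
Qed.

Section frame.
Variable lambda : phase_fun R n.
Hypotheses (mlambda : measurable_phase_fun lambda)
  (lambda_gt0 : forall x xi t, 0 <= t -> 0 < lambda x xi t).

Let lambda_ge0 x xi t : 0 <= t -> 0 <= lambda x xi t.
Proof. by move=> t0; exact/ltW/lambda_gt0. Qed.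

Lemma gain_integrand_ge0 x xi t p : 0 <= t ->
  0 <= gain_integrand lambda lambda x xi t p.
Proof. by move=> t0; rewrite mulr_ge0// addr_ge0// mulr_ge0// lambda_ge0. Qed.

Lemma loss_integrand_ge0 x xi t p : 0 <= t ->
  0 <= loss_integrand lambda lambda x xi t p.
Proof. by move=> t0; rewrite mulr_ge0// addr_ge0// mulr_ge0// lambda_ge0. Qed.

Lemma ler_norm_gain_integrand f A x xi t p : 0 <= t -> dominated lambda A f ->
  `|gain_integrand f f x xi t p| <=
    A ^+ 2 * gain_integrand lambda lambda x xi t p.
Proof.
move=> t0 fA; rewrite /gain_integrand normrM normr_id mulrA ler_wpM2r//.
by rewrite mulrDr (le_trans (ler_normD _ _))// lerD// ler_norm_mul_dominated//;
  exact: fA.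
Qed.

Lemma ler_norm_loss_integrand f A x xi t p : 0 <= t -> dominated lambda A f ->
  `|loss_integrand f f x xi t p| <=
    A ^+ 2 * loss_integrand lambda lambda x xi t p.
Proof.
move=> t0 fA; rewrite /loss_integrand normrM normr_id mulrA ler_wpM2r//.
by rewrite mulrDr (le_trans (ler_normD _ _))// lerD// ler_norm_mul_dominated//;
  exact: fA.
Qed.

Lemma ler_norm_gain_integrandB f g A D x xi t p : 0 <= t ->
  dominated lambda A f -> dominated lambda A g ->
  dominated lambda D (fun x xi t => f x xi t - g x xi t) ->
  `|gain_integrand f f x xi t p - gain_integrand g g x xi t p| <=
    2 * A * D * gain_integrand lambda lambda x xi t p.
Proof.
move=> t0 fA gA fgD; rewrite /gain_integrand -mulrBl normrM normr_id mulrA.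
rewrite ler_wpM2r// opprD addrACA mulrDr (le_trans (ler_normD _ _))// lerD//;
  by apply: ler_norm_mulB_dominated; [exact: fA|exact: gA|exact: fgD|exact: fgD].
Qed.

Lemma ler_norm_loss_integrandB f g A D x xi t p : 0 <= t ->
  dominated lambda A f -> dominated lambda A g ->
  dominated lambda D (fun x xi t => f x xi t - g x xi t) ->
  `|loss_integrand f f x xi t p - loss_integrand g g x xi t p| <=
    2 * A * D * loss_integrand lambda lambda x xi t p.
Proof.
move=> t0 fA gA fgD; rewrite /loss_integrand -mulrBl normrM normr_id mulrA.
rewrite ler_wpM2r// opprD addrACA mulrDr (le_trans (ler_normD _ _))// lerD//;
  by apply: ler_norm_mulB_dominated; [exact: fA|exact: gA|exact: fgD|exact: fgD].
Qed.

Local Open Scope ereal_scope.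

Let half_ge0 : (0 <= 2^-1 :> R)%R. Proof. by rewrite invr_ge0. Qed.

Lemma Qplus_ge0 x xi t : (0 <= t)%R -> 0 <= Qplus lambda lambda x xi t.
Proof.
move=> t0; rewrite QplusE mule_ge0//; apply: integral_ge0 => p _.
by rewrite lee_fin gain_integrand_ge0.
Qed.

Lemma Qminus_ge0 x xi t : (0 <= t)%R -> 0 <= Qminus lambda lambda x xi t.
Proof.
move=> t0; rewrite QminusE mule_ge0//; apply: integral_ge0 => p _.
by rewrite lee_fin loss_integrand_ge0.
Qed.

Lemma le_abse_Qplus f A x xi t : measurable_phase_fun f -> (0 <= t)%R ->
  dominated lambda A f ->
  `|Qplus f f x xi t| <= (A ^+ 2)%:E * Qplus lambda lambda x xi t.
Proof.
move=> mf t0 fA; rewrite !QplusE abseM/= ger0_norm// muleCA lee_pmul//.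
apply: le_abse_integral_dominated => //.
- exact: measurable_gain_integrand_pair.
- by move=> p; exact: gain_integrand_ge0.
- exact: measurable_gain_integrand_pair.
- exact: sqr_ge0.
- by move=> p; exact: ler_norm_gain_integrand.
Qed.

Lemma le_abse_Qminus f A x xi t : measurable_phase_fun f -> (0 <= t)%R ->
  dominated lambda A f ->
  `|Qminus f f x xi t| <= (A ^+ 2)%:E * Qminus lambda lambda x xi t.
Proof.
move=> mf t0 fA; rewrite !QminusE abseM/= ger0_norm// muleCA lee_pmul//.
apply: le_abse_integral_dominated => //.
- exact: measurable_loss_integrand_pair.
- by move=> p; exact: loss_integrand_ge0.
- exact: measurable_loss_integrand_pair.
- exact: sqr_ge0.
- by move=> p; exact: ler_norm_loss_integrand.
Qed.

Let half_integral_fin (I : \bar R) : 2^-1%:E * I < +oo -> I < +oo.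
Proof. by case: I => [r _|//|_]; rewrite ?ltry// gt0_muley// lte_fin invr_gt0. Qed.

(** Finiteness of the gain of the frame makes both gain integrals finite, so the factor 1/2 can be
    taken out of their difference without meeting oo - oo. *)
Lemma le_abse_QplusB f g A D x xi t :
  measurable_phase_fun f -> measurable_phase_fun g -> (0 <= t)%R ->
  (0 <= A)%R -> (0 <= D)%R -> dominated lambda A f -> dominated lambda A g ->
  dominated lambda D (fun x xi t => f x xi t - g x xi t)%R ->
  Qplus lambda lambda x xi t < +oo ->
  `|Qplus f f x xi t - Qplus g g x xi t| <=
    (2 * A * D)%:E * Qplus lambda lambda x xi t.
Proof.
move=> mf mg t0 A0 D0 fA gA fgD.
have mL := @measurable_gain_integrand_pair _ _ _ _ mlambda mlambda x xi _ t0.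
have mF := @measurable_gain_integrand_pair _ _ _ _ mf mf x xi _ t0.
have mG := @measurable_gain_integrand_pair _ _ _ _ mg mg x xi _ t0.
have L0 p : (0 <= gain_integrand lambda lambda x xi t p)%R.
  exact: gain_integrand_ge0.
rewrite !QplusE => /half_integral_fin Loo.
have fin := fun F c mF => @fin_num_integral_dominated _ _ _ _ _ mL L0 F c mF Loo.
rewrite -muleBr//; last by rewrite fin_num_adde_defr// (fin _ (A ^+ 2)%R)// => p;
  exact: ler_norm_gain_integrand.
rewrite abseM/= ger0_norm// muleCA lee_pmul//.
apply: (@le_abse_integralB_dominated _ _ _ _ _ mL L0 _ _ (A ^+ 2)%R) => //.
- by rewrite !mulr_ge0.
- by move=> p; exact: ler_norm_gain_integrand.
- by move=> p; exact: ler_norm_gain_integrand.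
- by move=> p; exact: ler_norm_gain_integrandB.
Qed.

Lemma le_abse_QminusB f g A D x xi t :
  measurable_phase_fun f -> measurable_phase_fun g -> (0 <= t)%R ->
  (0 <= A)%R -> (0 <= D)%R -> dominated lambda A f -> dominated lambda A g ->
  dominated lambda D (fun x xi t => f x xi t - g x xi t)%R ->
  Qminus lambda lambda x xi t < +oo ->
  `|Qminus f f x xi t - Qminus g g x xi t| <=
    (2 * A * D)%:E * Qminus lambda lambda x xi t.
Proof.
move=> mf mg t0 A0 D0 fA gA fgD.
have mL := @measurable_loss_integrand_pair _ _ _ _ mlambda mlambda x xi _ t0.
have mF := @measurable_loss_integrand_pair _ _ _ _ mf mf x xi _ t0.
have mG := @measurable_loss_integrand_pair _ _ _ _ mg mg x xi _ t0.
have L0 p : (0 <= loss_integrand lambda lambda x xi t p)%R.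
  exact: loss_integrand_ge0.
rewrite !QminusE => /half_integral_fin Loo.
have fin := fun F c mF => @fin_num_integral_dominated _ _ _ _ _ mL L0 F c mF Loo.
rewrite -muleBr//; last by rewrite fin_num_adde_defr// (fin _ (A ^+ 2)%R)// => p;
  exact: ler_norm_loss_integrand.
rewrite abseM/= ger0_norm// muleCA lee_pmul//.
apply: (@le_abse_integralB_dominated _ _ _ _ _ mL L0 _ _ (A ^+ 2)%R) => //.
- by rewrite !mulr_ge0.
- by move=> p; exact: ler_norm_loss_integrand.
- by move=> p; exact: ler_norm_loss_integrand.
- by move=> p; exact: ler_norm_loss_integrandB.
Qed.

(** The total collision rate of the frame serves as the single weight against which [Q] and its
    increments are measured. *)
Definition frame_rate x xi t : \bar R :=
  Qplus lambda lambda x xi t + Qminus lambda lambda x xi t.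

Lemma frame_rate_ge0 x xi t : (0 <= t)%R -> 0 <= frame_rate x xi t.
Proof. by move=> t0; apply: adde_ge0; [exact: Qplus_ge0|exact: Qminus_ge0]. Qed.

(** The triangle inequality |y - z| <= |y| + |z| holds for all extended reals, so infinite gain or
    loss needs no separate treatment. *)
Lemma le_abse_Q f A x xi t : measurable_phase_fun f -> (0 <= t)%R ->
  dominated lambda A f ->
  `|Q f f x xi t| <= (A ^+ 2)%:E * frame_rate x xi t.
Proof.
move=> mf t0 fA; rewrite /frame_rate.
rewrite (ge0_muleDr _ (Qplus_ge0 x xi t0) (Qminus_ge0 x xi t0)).
apply: (le_trans (lee_abs_sub _ _)); apply: leeD.
  exact: le_abse_Qplus.
exact: le_abse_Qminus.
Qed.

(* Since [0 < A] and [0 < D], the bound is +oo where the rate is: nothing is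
   claimed at the points where [Q] may be a difference of infinities. *)
Lemma le_abse_QB f g A D x xi t :
  measurable_phase_fun f -> measurable_phase_fun g -> (0 <= t)%R ->
  (0 < A)%R -> (0 < D)%R -> dominated lambda A f -> dominated lambda A g ->
  dominated lambda D (fun x xi t => f x xi t - g x xi t)%R ->
  `|Q f f x xi t - Q g g x xi t| <= (2 * A * D)%:E * frame_rate x xi t.
Proof.
move=> mf mg t0 A0 D0 fA gA fgD.
have AD0 : (0 < 2 * A * D)%R by rewrite !mulr_gt0.
have [rate_oo|] := eqVneq (frame_rate x xi t) +oo.
  by rewrite rate_oo gt0_muley ?lte_fin// leey.
rewrite -ltey => rate_fin; have P0 := Qplus_ge0 x xi t0.
have M0 := Qminus_ge0 x xi t0.
have Poo : Qplus lambda lambda x xi t < +oo.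
  by apply: le_lt_trans rate_fin; rewrite leeDl.
have Moo : Qminus lambda lambda x xi t < +oo.
  by apply: le_lt_trans rate_fin; rewrite leeDr.
have fin y z : `|y| <= (A ^+ 2)%:E * z -> z < +oo -> 0 <= z -> y \is a fin_num.
  move=> yz zoo z0; rewrite fin_num_abs (le_lt_trans yz)// lte_mul_pinfty//.
  by rewrite lee_fin sqr_ge0.
have fP := fin _ _ (le_abse_Qplus x xi mf t0 fA) Poo P0.
have gP := fin _ _ (le_abse_Qplus x xi mg t0 gA) Poo P0.
have fM := fin _ _ (le_abse_Qminus x xi mf t0 fA) Moo M0.
have gM := fin _ _ (le_abse_Qminus x xi mg t0 gA) Moo M0.
have -> : Q f f x xi t - Q g g x xi t =
    (Qplus f f x xi t - Qplus g g x xi t) -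
    (Qminus f f x xi t - Qminus g g x xi t).
  rewrite /Q -(fineK fP) -(fineK gP) -(fineK fM) -(fineK gM).
  have rearrange (a b c e : R) : (a - b - (c - e) = a - c - (b - e))%R by ring.
  by rewrite -!EFinB rearrange.
apply: (le_trans (lee_abs_sub _ _)); rewrite (ge0_muleDr _ P0 M0); apply: leeD.
  by apply: le_abse_QplusB => //; exact: ltW.
by apply: le_abse_QminusB => //; exact: ltW.
Qed.

End frame.
End pointwise.

(** * Integrals along characteristics and the Picard operator *)

Section time_integrals.
Context {R : realType} {n : nat}.
Implicit Types (f g lambda : phase_fun R n) (x xi y : 'rV[R]_n) (t s z A D : R).

Lemma measurable_characteristic x xi : measurable_fun [set: measurableTypeR R]
  (fun s : measurableTypeR R => x + (s : R) *: xi).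
Proof. by apply: measurable_fun_rowD => //; exact: measurable_fun_rowZ. Qed.

Lemma measurable_Q_characteristic f x xi z : measurable_phase_fun f -> 0 <= z ->
  measurable_fun (`[z, +oo[%classic : set (measurableTypeR R))
    (along_characteristic (Q f f) x xi).
Proof.
move=> mf z0.
apply: (@measurable_Q _ _ f f mf mf _ _ _ (fun s => x + (s : R) *: xi)%R (fun=> xi)
   (fun s => s)) => //.
- by move=> s /=; rewrite in_itv/= andbT; exact: le_trans.
- exact: measurable_funTS (measurable_characteristic _ _).
Qed.

Section frame.
Variable lambda : phase_fun R n.
Hypotheses (lambda_transport : linear_transport_solution lambda)
  (lambda_gt0 : forall x xi t, 0 <= t -> 0 < lambda x xi t).

Let mlambda : measurable_phase_fun lambda. Proof. by case: lambda_transport. Qed.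

Lemma lambda_char x xi t : 0 <= t -> lambda (x + t *: xi) xi t = lambda x xi 0.
Proof. by case: lambda_transport => _; exact. Qed.

(** Moves an estimate at (y, xi, t) to the foot of its characteristic, where the weights of the
    observer norm are taken. *)
Lemma lambda_backward y xi t : 0 <= t -> lambda y xi t = lambda (y - t *: xi) xi 0.
Proof. by move=> t0; rewrite -(lambda_char _ _ t0) subrK. Qed.

Local Open Scope ereal_scope.

Lemma measurable_Qplus_characteristic x xi z : (0 <= z)%R ->
  measurable_fun (`[z, +oo[%classic : set (measurableTypeR R))
    (along_characteristic (Qplus lambda lambda) x xi).
Proof.
move=> z0.
rewrite /along_characteristic.
apply: (@measurable_Qplus _ _ _ _ mlambda mlambda _ _ _
  (fun s => x + (s : R) *: xi)%R (fun=> xi) (fun s => s)) => //.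
- by move=> s /=; rewrite in_itv/= andbT; exact: le_trans.
- exact: measurable_funTS (measurable_characteristic _ _).
Qed.

Lemma measurable_Qminus_characteristic x xi z : (0 <= z)%R ->
  measurable_fun (`[z, +oo[%classic : set (measurableTypeR R))
    (along_characteristic (Qminus lambda lambda) x xi).
Proof.
move=> z0.
rewrite /along_characteristic.
apply: (@measurable_Qminus _ _ _ _ mlambda mlambda _ _ _
  (fun s => x + (s : R) *: xi)%R (fun=> xi) (fun s => s)) => //.
- by move=> s /=; rewrite in_itv/= andbT; exact: le_trans.
- exact: measurable_funTS (measurable_characteristic _ _).
Qed.

Lemma measurable_frame_rate_characteristic x xi z : (0 <= z)%R ->
  measurable_fun (`[z, +oo[%classic : set (measurableTypeR R))
    (along_characteristic (frame_rate lambda) x xi).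
Proof.
move=> z0; apply: emeasurable_funD.
  exact: measurable_Qplus_characteristic.
exact: measurable_Qminus_characteristic.
Qed.

Lemma le_weighted_sup (h : 'rV[R]_n -> 'rV[R]_n -> \bar R) x xi :
  h x xi <= (lambda x xi 0)%:E * weighted_sup lambda h.
Proof.
rewrite -lee_pdivrMl ?lambda_gt0//.
by apply: ereal_sup_ubound; exists (x, xi).
Qed.

Lemma weighted_sup_ge0 (h : 'rV[R]_n -> 'rV[R]_n -> \bar R) :
  (forall x xi, 0 <= h x xi) -> 0 <= weighted_sup lambda h.
Proof.
move=> h0; rewrite -(@lee_pmul2l _ (lambda 0 0 0)%:E) ?lte_fin ?lambda_gt0// mule0.
by apply: le_trans (le_weighted_sup h 0%R 0%R).
Qed.

(** Gain and loss are integrated separately, since [scattering_tail] adds two suprema rather than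
    taking the supremum of a sum. All later uses of the frame conditions pass through this
    inequality. *)
Lemma integral_frame_rate_le x xi z : (0 <= z)%R ->
  \int[lebesgue_measure]_(s in `[z, +oo[)
    along_characteristic (frame_rate lambda) x xi s <=
  (lambda x xi 0)%:E * scattering_tail lambda z.
Proof.
move=> z0; have pos (s : R) : `[z, +oo[%classic s -> (0 <= s)%R.
  by rewrite /= in_itv/= andbT; exact: le_trans.
have P0 x1 xi1 : 0 <= tail_integral (Qplus lambda lambda) z x1 xi1.
  by apply: integral_ge0 => s /pos s0; exact: Qplus_ge0.
have M0 x1 xi1 : 0 <= tail_integral (Qminus lambda lambda) z x1 xi1.
  by apply: integral_ge0 => s /pos s0; exact: Qminus_ge0.
rewrite (@ge0_integralD _ _ _ lebesgue_measure _ _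
  (along_characteristic (Qplus lambda lambda) x xi)
  (along_characteristic (Qminus lambda lambda) x xi)) //; first last.
- exact: measurable_Qminus_characteristic.
- by move=> s /pos s0; exact: Qminus_ge0.
- exact: measurable_Qplus_characteristic.
- by move=> s /pos s0; exact: Qplus_ge0.
rewrite /scattering_tail (ge0_muleDr _ (weighted_sup_ge0 P0) (weighted_sup_ge0 M0)).
by apply: leeD; exact: le_weighted_sup.
Qed.

Section dominated_solution.
Variables (f : phase_fun R n) (A : R).
Hypotheses (mf : measurable_phase_fun f) (fA : dominated lambda A f).

(** Integrates [le_abse_Q] along the characteristic. The case [z = 0] bounds the Picard operator;
    letting [z] grow gives uniform scattering. *)
Lemma tail_integral_abs_Q_le x xi z : (0 <= z)%R ->
  tail_integral (fun x xi t => `|Q f f x xi t|) z x xi <=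
    (A ^+ 2)%:E * ((lambda x xi 0)%:E * scattering_tail lambda z).
Proof.
move=> z0; have pos (s : R) : `[z, +oo[%classic s -> (0 <= s)%R.
  by rewrite /= in_itv/= andbT; exact: le_trans.
apply: le_trans (lee_wpmul2l _ (integral_frame_rate_le x xi z0)); last first.
  by rewrite lee_fin sqr_ge0.
rewrite -ge0_integralZl_EFin ?sqr_ge0//; first last.
- exact: measurable_frame_rate_characteristic.
- by move=> s /pos s0; exact: frame_rate_ge0.
apply: ge0_le_integral => //.
- by move=> s _; exact: abse_ge0.
- rewrite /along_characteristic; apply: measurableT_comp => //.
  exact: (measurable_Q_characteristic x xi mf z0).
- by apply: measurable_funeM; exact: measurable_frame_rate_characteristic.
- by move=> s /pos s0; exact: le_abse_Q.
Qed.

End dominated_solution.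

(** * Time kernels acting on the collision term, with [K] the total size of the frame *)

Variable K : R.
Hypothesis tailK : scattering_tail lambda 0 = K%:E.

Lemma integrable_Q_characteristic f A x xi : measurable_phase_fun f ->
  dominated lambda A f ->
  lebesgue_measure.-integrable (`[0%R, +oo[%classic : set (measurableTypeR R))
    (along_characteristic (Q f f) x xi).
Proof.
move=> mf fA; apply/integrableP; split; first exact: measurable_Q_characteristic.
apply: (le_lt_trans (tail_integral_abs_Q_le mf fA x xi (lexx 0%R))).
by rewrite tailK -!EFinM ltry.
Qed.

(** With the integration domain fixed to the half line, the dependence on [t] sits entirely in the
    kernel, and one set of estimates covers integrals over [0, t], over ]t, oo[ and over all
    times. *)
Definition kernel_integral (k : R -> R) f x xi : \bar R :=
  \int[lebesgue_measure]_(s in `[0%R, +oo[)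
    ((k s)%:E * along_characteristic (Q f f) x xi s).

Section kernel.
Variable k : measurableTypeR R -> R.
Hypotheses (mk : measurable_fun setT k) (k1 : forall s, (`|k s| <= 1)%R).

Let le_abse_kernel f x xi s : `|(k s)%:E * along_characteristic (Q f f) x xi s| <=
  `|along_characteristic (Q f f) x xi s|.
Proof. by rewrite abseM/= -[leRHS]mul1e lee_wpmul2r// lee_fin. Qed.

Let mkQ f x xi : measurable_phase_fun f ->
  measurable_fun (`[0%R, +oo[%classic : set (measurableTypeR R))
    (fun s => (k s)%:E * along_characteristic (Q f f) x xi s).
Proof.
move=> mf; apply: emeasurable_funM.
  by apply/measurable_EFinP; exact: measurable_funTS.
exact: measurable_Q_characteristic.
Qed.

Lemma integrable_kernel f A x xi : measurable_phase_fun f ->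
  dominated lambda A f ->
  lebesgue_measure.-integrable (`[0%R, +oo[%classic : set (measurableTypeR R))
    (fun s => (k s)%:E * along_characteristic (Q f f) x xi s).
Proof.
move=> mf fA.
apply: le_integrable (integrable_Q_characteristic x xi mf fA) => //.
exact: mkQ.
Qed.

Lemma le_abse_kernel_integral f A x xi : measurable_phase_fun f ->
  dominated lambda A f ->
  `|kernel_integral k f x xi| <= (A ^+ 2 * (lambda x xi 0 * K))%:E.
Proof.
move=> mf fA; rewrite /kernel_integral EFinM (EFinM (lambda x xi 0%R)) -tailK.
apply: (le_trans (le_abse_integral lebesgue_measure _ (mkQ x xi mf))) => //.
apply: le_trans (tail_integral_abs_Q_le mf fA x xi (lexx 0%R)).
apply: ge0_le_integral => //.
- by apply: measurableT_comp => //; exact: mkQ.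
- rewrite /along_characteristic; apply: measurableT_comp => //.
  exact: (measurable_Q_characteristic x xi mf (lexx 0%R)).
Qed.

Lemma kernel_integral_fin f A x xi : measurable_phase_fun f ->
  dominated lambda A f -> kernel_integral k f x xi \is a fin_num.
Proof.
move=> mf fA; rewrite fin_num_abs.
by rewrite (le_lt_trans (le_abse_kernel_integral x xi mf fA))// ltry.
Qed.

(** Both weighted collision terms are integrable, so the difference becomes one integral; its
    integrand is at most 2 A D times the frame rate because |k| <= 1. *)
Lemma le_abse_kernel_integralB f g A D x xi :
  measurable_phase_fun f -> measurable_phase_fun g ->
  (0 < A)%R -> (0 < D)%R -> dominated lambda A f -> dominated lambda A g ->
  dominated lambda D (fun x xi t => f x xi t - g x xi t)%R ->
  `|kernel_integral k f x xi - kernel_integral k g x xi| <=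
    (2 * A * D * (lambda x xi 0 * K))%:E.
Proof.
move=> mf mg A0 D0 fA gA fgD; rewrite /kernel_integral.
have AD0 : (0 < 2 * A * D)%R by rewrite !mulr_gt0.
have [iF iG] := (integrable_kernel x xi mf fA, integrable_kernel x xi mg gA).
rewrite -integralB//.
have mB : measurable_fun (`[0%R, +oo[%classic : set (measurableTypeR R))
    (fun s => (k s)%:E * along_characteristic (Q f f) x xi s -
              (k s)%:E * along_characteristic (Q g g) x xi s).
  by apply: emeasurable_funB; exact: mkQ.
apply: (le_trans (le_abse_integral lebesgue_measure _ mB)) => //.
rewrite EFinM (EFinM (lambda x xi 0%R)) -tailK.
apply: le_trans (lee_wpmul2l _ (integral_frame_rate_le x xi (lexx 0%R))); last first.
  by rewrite lee_fin ltW.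
have rate0 s : `[0%R, +oo[%classic s ->
    0 <= along_characteristic (frame_rate lambda) x xi s.
  by rewrite /= in_itv/= andbT => s0; exact: frame_rate_ge0.
have mrate := measurable_frame_rate_characteristic x xi (lexx 0%R).
rewrite -ge0_integralZl_EFin//; last exact: ltW.
apply: ge0_le_integral => //.
- exact: measurableT_comp.
- exact: measurable_funeM.
move=> s s0; have s0' : (0 <= s)%R by move: s0; rewrite /= in_itv/= andbT.
have := rate0 _ s0; rewrite /along_characteristic.
set r := frame_rate _ _ _ _ => r0.
(* Where the rate is infinite the bound is +oo, because 2 A D > 0. Elsewhere both values of [Q] are
   finite and the kernel factors out of their difference. *)
have [->|] := eqVneq r +oo; first by rewrite gt0_muley ?lte_fin// leey.
rewrite -ltey => roo.
have fin h : measurable_phase_fun h -> dominated lambda A h ->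
    Q h h (x + s *: xi)%R xi s \is a fin_num.
  move=> mh hA; rewrite fin_num_abs.
  apply: (le_lt_trans (le_abse_Q mlambda lambda_gt0 _ _ mh s0' hA)).
  by rewrite lte_mul_pinfty// lee_fin sqr_ge0.
rewrite -muleBr//; last by rewrite fin_num_adde_defr// fin.
rewrite abseM/=; apply: (@le_trans _ _ (1 * ((2 * A * D)%:E * r))).
  by rewrite lee_pmul// ?lee_fin//; exact: le_abse_QB.
by rewrite mul1e.
Qed.

End kernel.

(** * The Picard operator attached to a kernel and a datum *)

Section picard.
Variables (k : R -> R -> R) (h : 'rV[R]_n -> 'rV[R]_n -> R).
Hypotheses
  (mk : measurable_fun [set: measurableTypeR R * measurableTypeR R]
    (fun p : measurableTypeR R * measurableTypeR R => k p.1 p.2))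
  (k1 : forall t s, (`|k t s| <= 1)%R)
  (mh : measurable_fun [set: 'rV[R]_n * 'rV[R]_n] (fun p => h p.1 p.2)).

(** The point y - t xi is the foot of the characteristic reaching y at time t, so this is the
    fixed-point equation along characteristics written at a fixed point of phase space. The datum
    [h] will be an initial value or a scattering state. *)
Definition picard f y xi t : R :=
  (h (y - t *: xi) xi + fine (kernel_integral (k t) f (y - t *: xi) xi))%R.

Let mkt t : measurable_fun [set: measurableTypeR R] (k t).
Proof. exact: (measurable_fun_pair2 t mk). Qed.

Lemma picard_char f x xi t : picard f (x + t *: xi)%R xi t =
  (h x xi + fine (kernel_integral (k t) f x xi))%R.
Proof. by rewrite /picard addrK. Qed.

Lemma dominated_picard f A H : measurable_phase_fun f -> dominated lambda A f ->
  (forall x xi, `|h x xi| <= H * lambda x xi 0)%R ->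
  dominated lambda (H + A ^+ 2 * K) (picard f).
Proof.
move=> mf fA hH y xi t t0; rewrite (lambda_backward _ _ t0).
rewrite mulrDl (le_trans (ler_normD _ _))// lerD//.
rewrite mulrAC -mulrA -lee_fin -abse_EFin fineK; last first.
  exact: (kernel_integral_fin (mkt t) (k1 t) _ _ mf fA).
exact: (le_abse_kernel_integral (mkt t) (k1 t)).
Qed.

(** The datum cancels in the difference, so the ratio 2 A K depends only on the radius of the ball
    and on the frame. *)
Lemma dominated_picardB f g A D :
  measurable_phase_fun f -> measurable_phase_fun g ->
  (0 < A)%R -> (0 < D)%R -> dominated lambda A f -> dominated lambda A g ->
  dominated lambda D (fun x xi t => f x xi t - g x xi t)%R ->
  dominated lambda (2 * A * K * D)
    (fun x xi t => picard f x xi t - picard g x xi t)%R.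
Proof.
move=> mf mg A0 D0 fA gA fgD y xi t t0; rewrite (lambda_backward _ _ t0).
rewrite /picard opprD addrACA subrr add0r.
have -> : (2 * A * K * D * lambda (y - t *: xi) xi 0 =
  2 * A * D * (lambda (y - t *: xi) xi 0 * K))%R by ring.
have fin u := kernel_integral_fin (mkt t) (k1 t) (y - t *: xi)%R xi (f := u).
have := le_abse_kernel_integralB (mkt t) (k1 t) (y - t *: xi)%R xi mf mg
  A0 D0 fA gA fgD.
move: (fin _ _ mf fA) (fin _ _ mg gA).
case: (kernel_integral (k t) f _ _) => // a _.
by case: (kernel_integral (k t) g _ _) => // b _; rewrite lee_fin.
Qed.

Lemma measurable_phase_fun_picard f : measurable_phase_fun f ->
  measurable_phase_fun (picard f).
Proof.
move=> mf.
pose S := ('rV[R]_n * 'rV[R]_n * measurableTypeR R)%type.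
have my : measurable_fun [set: S] (fun p : S => p.1.1 - (p.2 : R) *: p.1.2)%R.
  apply: measurable_fun_rowB => //; first exact: measurableT_comp.
  apply: measurable_fun_rowZ => //; exact: measurableT_comp.
have mxi : measurable_fun [set: S] (fun p : S => p.1.2).
  exact: measurableT_comp.
apply: measurable_funTS; apply: measurable_funD.
  pose e (p : S) := (p.1.1 - (p.2 : R) *: p.1.2, p.1.2)%R.
  apply: (measurableT_comp (g := e) mh).
  exact: measurable_fun_pair.
apply: (measurableT_comp (@fine_measurable R setT measurableT)).
(* The variables (y, xi, t) are parameters and s is integrated. [f] is evaluated only at times s >=
   0, so t may range over the whole line. *)
pose F (q : S * measurableTypeR R) := (k q.1.2 q.2)%:E *
  Q f f (q.1.1.1 - (q.1.2 : R) *: q.1.1.2 + (q.2 : R) *: q.1.1.2)%R q.1.1.2 q.2.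
apply: (@measurable_parametric_integral _ _ _ _ _ lebesgue_measure setT
  `[0%R, +oo[%classic F) => //.
have mD : measurable ([set: S] `*` (`[0%R, +oo[%classic : set (measurableTypeR R))).
  exact: measurableX.
apply: emeasurable_funM.
  apply/measurable_EFinP; apply: measurable_funTS.
  pose e (q : S * measurableTypeR R) := (q.1.2, q.2).
  apply: (measurableT_comp (g := e) mk).
  apply: measurable_fun_pair => //; exact: measurableT_comp.
apply: (@measurable_Q _ _ _ _ mf mf _ _ _
  (fun q : S * measurableTypeR R =>
    q.1.1.1 - (q.1.2 : R) *: q.1.1.2 + (q.2 : R) *: q.1.1.2)%R
  (fun q : S * measurableTypeR R => q.1.1.2)
  (fun q : S * measurableTypeR R => q.2)) => //.
- by move=> q [_ /=]; rewrite in_itv/= andbT.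
- apply: measurable_funTS; apply: measurable_fun_rowD => //.
    exact: (measurableT_comp my).
  apply: measurable_fun_rowZ => //; exact: (measurableT_comp mxi).
- by apply: measurable_funTS; exact: (measurableT_comp mxi).
  by apply: measurable_funTS; exact: measurable_snd.
Qed.

End picard.
End frame.
End time_integrals.

(** * Fixed point *)

Section geometric_sequences.
Context {R : realType}.
Implicit Types (C q : R).

Lemma geometric_bound_eq0 (a C q : R) : 0 <= q < 1 ->
  (forall k, `|a| <= C * q ^+ k) -> a = 0.
Proof.
move=> /andP[q0 q1] aC; apply/normr0_eq0/eqP; rewrite eq_le normr_ge0 andbT.
have Cq := @cvg_geometric R C q; rewrite ger0_norm// in Cq.
by apply: (ler_cvg_to (cvg_cst _) (Cq q1)); apply: nearW.
Qed.

(** The explicit rate matters as much as convergence: it will bound the distance from each iterate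
    to the limit relative to [lambda]. *)
Lemma geometric_cvg (u : R^nat) (C q : R) : 0 <= q < 1 -> 0 <= C ->
  (forall k, `|u k.+1 - u k| <= C * q ^+ k) ->
  exists2 l, u @ \oo --> l & forall k, `|u k - l| <= C / (1 - q) * q ^+ k.
Proof.
move=> /andP[q0 q1] C0 uC; have q1' : 0 < 1 - q by rewrite subr_gt0.
(* The right-hand side is the sum of C q^i over k <= i < k + j. *)
have dist k j : `|u (k + j)%N - u k| <= C / (1 - q) * q ^+ k * (1 - q ^+ j).
  elim: j => [|j IH]; first by rewrite addn0 !subrr normr0 mulr0.
  rewrite addnS -(subrK (u (k + j)%N) (u (k + j).+1)) -addrA.
  apply: (le_trans (ler_normD _ _)); apply: (le_trans (lerD (uC _) IH)).
  rewrite le_eqVlt; apply/orP; left; apply/eqP.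
  rewrite exprD exprS; field; exact: lt0r_neq0.
have {}dist k m : (k <= m)%N -> `|u m - u k| <= C / (1 - q) * q ^+ k.
  move=> km; rewrite -(subnKC km); apply: (le_trans (dist _ _)).
  rewrite ler_piMr ?mulr_ge0 ?invr_ge0 ?exprn_ge0 ?(ltW q1')//.
  by rewrite gerBl exprn_ge0.
have ucvg : cvg (u @ \oo).
  apply: cauchy_cvg; apply: cauchy_exP => e e0.
  have Cq := @cvg_geometric R (C / (1 - q)) q; rewrite ger0_norm// in Cq.
  have [k _ /(_ _ (leqnn k)) kP] := (cvgr0Pnorm_lt _).1 (Cq q1) _ e0.
  exists (u k), k => // m /= km.
  rewrite -ball_normE /ball_ /= distrC (le_lt_trans (dist _ _ km))//.
  exact: le_lt_trans (ler_norm _) kP.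
exists (lim (u @ \oo)) => // k; rewrite distrC.
apply: (cvgr_to_le (cvg_norm (cvgB ucvg (cvg_cst (u k))))).
by exists k => // m /= km; exact: dist.
Qed.

End geometric_sequences.

(** * Contraction of the scattering ball *)

Section fixed_point.
Context {R : realType} {n : nat}.
Variables (lambda : phase_fun R n) (K N : R) (k : R -> R -> R)
  (h : 'rV[R]_n -> 'rV[R]_n -> R).
Hypotheses (lambda_transport : linear_transport_solution lambda)
  (lambda_gt0 : forall x xi t, 0 <= t -> 0 < lambda x xi t)
  (tailK : scattering_tail lambda 0 = K%:E)
  (mk : measurable_fun [set: measurableTypeR R * measurableTypeR R]
    (fun p : measurableTypeR R * measurableTypeR R => k p.1 p.2))
  (k1 : forall t s, `|k t s| <= 1)
  (mh : measurable_fun [set: 'rV[R]_n * 'rV[R]_n] (fun p => h p.1 p.2))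
  (K_gt0 : 0 < K) (N_gt0 : 0 < N) (contractive : 2 * N * K < 1)
  (h_le : forall x xi, `|h x xi| <= N / 2 * lambda x xi 0).

Let q := 2 * N * K.

Let q_gt0 : 0 < q. Proof. by rewrite !mulr_gt0. Qed.

Let q01 : 0 <= q < 1. Proof. by rewrite contractive ltW. Qed.

Let lambda_ge0 x xi t : 0 <= t -> 0 <= lambda x xi t.
Proof. by move=> t0; exact/ltW/lambda_gt0. Qed.

(** The datum contributes at most N / 2 and the collisions at most N^2 K, which is below N / 2
    because 2 N K < 1. Hence the datum is taken in the ball of half the radius. *)
Lemma dominated_picard_ball f : measurable_phase_fun f ->
  dominated lambda N f -> dominated lambda N (picard k h f).
Proof.
move=> mf fN x xi t t0.
apply: (le_trans (dominated_picard lambda_transport lambda_gt0 tailK mk k1 mf fN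
  h_le x xi t0)).
rewrite ler_wpM2r ?lambda_ge0//.
have -> : N / 2 + N ^+ 2 * K = N / 2 * (1 + 2 * N * K) by field.
rewrite [leRHS](_ : N = N / 2 * 2); last by field.
by rewrite ler_wpM2l ?divr_ge0 ?ltW// -[ltRHS]/(1 + 1) ltrD2l.
Qed.

Lemma picard_contraction f g D : measurable_phase_fun f ->
  measurable_phase_fun g -> 0 < D -> dominated lambda N f ->
  dominated lambda N g ->
  dominated lambda D (fun x xi t => f x xi t - g x xi t) ->
  dominated lambda (q * D)
    (fun x xi t => picard k h f x xi t - picard k h g x xi t).
Proof.
move=> mf mg D0; exact: (dominated_picardB lambda_transport lambda_gt0 tailK).
Qed.

(** Two elements of the ball differ by at most 2 N [lambda], and each application of the operator
    multiplies this bound by q. *)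
Lemma picard_fixed_point_unique f g :
  measurable_phase_fun f -> measurable_phase_fun g ->
  dominated lambda N f -> dominated lambda N g ->
  (forall x xi t, 0 <= t -> f x xi t = picard k h f x xi t) ->
  (forall x xi t, 0 <= t -> g x xi t = picard k h g x xi t) ->
  forall x xi t, 0 <= t -> f x xi t = g x xi t.
Proof.
move=> mf mg fN gN ff gg x xi t t0; apply/eqP; rewrite -subr_eq0; apply/eqP.
have dist m : dominated lambda (2 * N * q ^+ m) (fun x xi t => f x xi t - g x xi t).
  elim: m => [|m IH] y eta s s0.
    rewrite expr0 mulr1 (le_trans (ler_normB _ _))//.
    by rewrite mulr_natl mulr2n mulrDl lerD ?fN ?gN.
  rewrite ff// gg// exprS mulrCA.
  by apply: picard_contraction => //; rewrite !mulr_gt0// exprn_gt0.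
apply: (@geometric_bound_eq0 _ _ (2 * N * lambda x xi t) q) => // m.
by rewrite mulrAC; exact: dist.
Qed.

(** The contraction argument is run pointwise on the iterates starting from 0, with bounds uniform
    relative to [lambda]; measurability survives because the limit is pointwise. *)
Lemma picard_fixed_point_exists : exists f, [/\ measurable_phase_fun f,
  dominated lambda N f &
  forall x xi t, 0 <= t -> f x xi t = picard k h f x xi t].
Proof.
pose it m := iter m (picard k h) (fun _ _ _ => 0).
have itP m : measurable_phase_fun (it m) /\ dominated lambda N (it m).
  elim: m => [|m [mIH IH]].
    split; first exact: measurable_funTS.
    by move=> x xi t t0; rewrite normr0 mulr_ge0 ?lambda_ge0// ltW.
  split; first exact: measurable_phase_fun_picard.
  exact: dominated_picard_ball.
have itS m : dominated lambda (N * q ^+ m)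
    (fun x xi t => it m.+1 x xi t - it m x xi t).
  elim: m => [|m IH].
    move=> x xi t t0; rewrite expr0 mulr1 subr0.
    by have [_] := itP 1%N; exact.
  have [mm dm] := itP m; have [mm1 dm1] := itP m.+1; rewrite exprS mulrCA.
  by apply: picard_contraction => //; rewrite mulr_gt0// exprn_gt0.
(* The condition on [t] is placed under the existential so that a limit can be chosen for every [t];
   at negative times the witness is 0. *)
have cvg_it x xi t : exists l, 0 <= t ->
    (it m x xi t @[m --> \oo] --> l) /\
    forall m, `|it m x xi t - l| <= N * lambda x xi t / (1 - q) * q ^+ m.
  have [t0|t0] := leP 0 t; last by exists 0.
  have [|m|l lcvg lle] := geometric_cvg (u := fun m => it m x xi t)
    (C := N * lambda x xi t) q01.
  - by rewrite mulr_ge0 ?lambda_ge0// ltW.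
  - by rewrite mulrAC; exact: itS.
  by exists l.
pose f x xi (t : R) : R := projT1 (cid (cvg_it x xi t)).
have f_cvg x xi t : 0 <= t -> it m x xi t @[m --> \oo] --> f x xi t.
  by move=> t0; rewrite /f; case: cid => l /= /(_ t0)[].
have f_le m : dominated lambda (N / (1 - q) * q ^+ m)
    (fun x xi t => it m x xi t - f x xi t).
  move=> x xi t t0; rewrite /f; case: cid => l /= /(_ t0)[_ /(_ m)].
  by rewrite (_ : N * lambda x xi t / (1 - q) * q ^+ m =
    N / (1 - q) * q ^+ m * lambda x xi t); last by ring.
have mf : measurable_phase_fun f.
  apply: (measurable_fun_cvg (h := fun m p => it m p.1.1 p.1.2 p.2)).
    by move=> m; case: (itP m).
  by move=> [[x xi] t] [_ /=]; rewrite in_itv/= andbT; exact: f_cvg.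
have fN : dominated lambda N f.
  move=> x xi t t0; apply: (cvgr_to_le (cvg_norm (f_cvg x xi t t0))).
  by apply: nearW => m; case: (itP m) => _; exact.
exists f; split => // x xi t t0.
apply/eqP; rewrite -subr_eq0; apply/eqP.
have fin0 : 0 < N / (1 - q) by rewrite divr_gt0// subr_gt0.
(* Compare f with its image through iterate m+1. The distance from f to that iterate costs C
   q^(m+1), and contraction between iterate m and f costs q C q^m; together they give C (q + q)
   q^m. *)
apply: (@geometric_bound_eq0 _ _ (N / (1 - q) * lambda x xi t * (q + q)) q) => // m.
have [mm dm] := itP m.
have D0 : 0 < N / (1 - q) * q ^+ m by rewrite mulr_gt0// exprn_gt0.
have := picard_contraction mm mf D0 dm fN (f_le m) x xi t0.
have := f_le m.+1 x xi _ t0; rewrite [it m.+1 x xi t]/=.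
move: (picard _ _ f _ _ _) (picard _ _ _ _ _ _) (f _ _ _) => a b c bc ba.
rewrite (le_trans (ler_distD b _ _))// distrC (le_trans (lerD bc ba))//.
by rewrite exprS le_eqVlt; apply/orP; left; apply/eqP; ring.
Qed.

End fixed_point.

(** * Mild solutions and scattering *)

Section mild_solutions.
Context {R : realType} {n : nat}.
Implicit Types (f g lambda : phase_fun R n) (h : 'rV[R]_n -> 'rV[R]_n -> R)
  (x xi : 'rV[R]_n) (t s : R).

(** For s >= 0 the two kernels are the indicator of [0, t] and minus the indicator of ]t, oo[. They
    turn the initial value problem and the problem with prescribed scattering state into fixed
    points of one operator. *)
Definition before_kernel t s : R := if s <= t then 1 else 0.

Definition after_kernel t s : R := if s <= t then 0 else -1.

Let measurable_if_le (a b : R) :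
  measurable_fun [set: measurableTypeR R * measurableTypeR R]
    (fun p : measurableTypeR R * measurableTypeR R =>
      if (p.2 : R) <= p.1 then a else b).
Proof.
apply: measurable_fun_ifT => //.
by apply: measurable_fun_ler; [exact: measurable_snd|exact: measurable_fst].
Qed.

Lemma measurable_before_kernel :
  measurable_fun [set: measurableTypeR R * measurableTypeR R]
    (fun p : measurableTypeR R * measurableTypeR R => before_kernel p.1 p.2).
Proof. exact: measurable_if_le. Qed.

Lemma measurable_after_kernel :
  measurable_fun [set: measurableTypeR R * measurableTypeR R]
    (fun p : measurableTypeR R * measurableTypeR R => after_kernel p.1 p.2).
Proof. exact: measurable_if_le. Qed.

Lemma normr_before_kernel t s : `|before_kernel t s| <= 1.
Proof. by rewrite /before_kernel; case: ifP; rewrite ?normr1 ?normr0. Qed.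

Lemma normr_after_kernel t s : `|after_kernel t s| <= 1.
Proof. by rewrite /after_kernel; case: ifP; rewrite ?normrN ?normr1 ?normr0. Qed.

(** For dominated [f] the integral is finite and [fine] loses nothing, so the equations below are
    identities between real numbers. *)
Definition collision_upto f x xi t : R :=
  fine (\int[lebesgue_measure]_(s in `[0%R, t])
    along_characteristic (Q f f) x xi s)%E.

Definition total_collision f x xi : R :=
  fine (\int[lebesgue_measure]_(s in `[0%R, +oo[)
    along_characteristic (Q f f) x xi s)%E.

Local Open Scope ereal_scope.

Lemma kernel_integral_before f x xi t :
  kernel_integral (before_kernel t) f x xi =
  \int[lebesgue_measure]_(s in `[0%R, t]) along_characteristic (Q f f) x xi s.
Proof.
rewrite /kernel_integral integral_mkcond [RHS]integral_mkcond.
apply: eq_integral => s _; rewrite !patchE !mem_setE /before_kernel !in_itv/= andbT.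
case: (0 <= s)%R => //=; case: (s <= t)%R; first by rewrite mul1e.
by rewrite mul0e.
Qed.

Lemma kernel_integral_cst1 f x xi : kernel_integral (fun=> 1%R) f x xi =
  \int[lebesgue_measure]_(s in `[0%R, +oo[) along_characteristic (Q f f) x xi s.
Proof. by apply: eq_integral => s _; rewrite mul1e. Qed.

Lemma kernel_integral_after f x xi t : (0 <= t)%R ->
  kernel_integral (after_kernel t) f x xi =
  \int[lebesgue_measure]_(s in `]t, +oo[) (- along_characteristic (Q f f) x xi s).
Proof.
move=> t0; rewrite /kernel_integral integral_mkcond [RHS]integral_mkcond.
apply: eq_integral => s _; rewrite !patchE !mem_setE /after_kernel !in_itv/= !andbT.
have [st|ts] := leP s t; first by case: ifP; rewrite ?mul0e.
by rewrite (le_trans t0 (ltW ts)) EFinN mulN1e.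
Qed.

Section frame.
Variables (lambda : phase_fun R n) (K : R).
Hypotheses (lambda_transport : linear_transport_solution lambda)
  (lambda_gt0 : forall x xi t, (0 <= t)%R -> (0 < lambda x xi t)%R)
  (tailK : scattering_tail lambda 0 = K%:E).

Section dominated.
Variables (f : phase_fun R n) (A : R).
Hypotheses (mf : measurable_phase_fun f) (fA : dominated lambda A f).

Let iQ x xi (D : set (measurableTypeR R)) : measurable D ->
  D `<=` `[0%R, +oo[%classic -> lebesgue_measure.-integrable D
    (along_characteristic (Q f f) x xi).
Proof.
move=> mD D0.
have := integrable_Q_characteristic lambda_transport lambda_gt0 tailK x xi mf fA.
exact: integrableS.
Qed.

Let sub0t t : `[0%R, t]%classic `<=` `[0%R, +oo[%classic.
Proof. by move=> s /=; rewrite !in_itv/= andbT => /andP[]. Qed.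

Let subt t : (0 <= t)%R -> `]t, +oo[%classic `<=` `[0%R, +oo[%classic.
Proof. by move=> t0 s /=; rewrite !in_itv/= !andbT => /ltW; exact: le_trans. Qed.

Lemma collision_uptoE x xi t : (collision_upto f x xi t)%:E =
  \int[lebesgue_measure]_(s in `[0%R, t]) along_characteristic (Q f f) x xi s.
Proof. by rewrite fineK//; apply: integrable_fin_num => //; exact: iQ. Qed.

Lemma total_collisionE x xi : (total_collision f x xi)%:E =
  \int[lebesgue_measure]_(s in `[0%R, +oo[) along_characteristic (Q f f) x xi s.
Proof. by rewrite fineK//; apply: integrable_fin_num => //; exact: iQ. Qed.

Lemma collision_after x xi t : (0 <= t)%R ->
  (total_collision f x xi - collision_upto f x xi t)%:E =
  \int[lebesgue_measure]_(s in `]t, +oo[) along_characteristic (Q f f) x xi s.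
Proof.
move=> t0; rewrite EFinB total_collisionE.
have tE : `[0%R, +oo[%classic = `[0%R, t]%classic `|` `]t, +oo[%classic.
  apply/seteqP; split=> s /=; rewrite !in_itv/= !andbT.
    by move=> s0; have [st|ts] := leP s t; [left; rewrite s0|right].
  by case=> [/andP[]//|/ltW]; exact: le_trans.
rewrite tE integral_setU//.
- by rewrite -collision_uptoE addeAC -EFinB subrr add0e.
- by rewrite -tE; exact: measurable_Q_characteristic.
- apply/disj_setPS => s [] /=; rewrite !in_itv/= andbT => /andP[_ st].
  by rewrite ltNge st.
Qed.

Lemma collision_upto0 x xi : collision_upto f x xi 0 = 0%R.
Proof. by rewrite /collision_upto set_itv1 integral_set1. Qed.

(** The collisions still to come after time t are controlled by the tail of the frame, uniformly
    relative to [lambda]. *)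
Lemma collision_after_le x xi t : (0 <= t)%R ->
  `|total_collision f x xi - collision_upto f x xi t|%:E <=
    (lambda x xi 0)%:E * ((A ^+ 2)%:E * scattering_tail lambda t).
Proof.
move=> t0; rewrite -abse_EFin collision_after// muleCA.
have mQ := measurable_Q_characteristic x xi mf t0.
have sub : `]t, +oo[%classic `<=` `[t, +oo[%classic.
  by move=> s /=; rewrite !in_itv/= !andbT; exact: ltW.
have mQ' := measurable_funS _ sub mQ.
apply: (le_trans (le_abse_integral lebesgue_measure _ (mQ' _))) => //.
apply: le_trans (tail_integral_abs_Q_le lambda_transport lambda_gt0 mf fA x xi t0).
rewrite /tail_integral /along_characteristic; apply: ge0_subset_integral => //.
exact: measurableT_comp.
Qed.

Lemma picard_before h x xi t : picard before_kernel h f (x + t *: xi)%R xi t =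
  (h x xi + collision_upto f x xi t)%R.
Proof. by rewrite picard_char kernel_integral_before. Qed.

(** Writing the remainder as a difference of [collision_upto] and [total_collision] reduces the
    passage between the two fixed-point equations to algebra. *)
Lemma picard_after h x xi t : (0 <= t)%R ->
  picard after_kernel h f (x + t *: xi)%R xi t =
  (h x xi + (collision_upto f x xi t - total_collision f x xi))%R.
Proof.
move=> t0; rewrite picard_char kernel_integral_after// integralN; last first.
  apply: integrable_add_def => //; apply: iQ => //; exact: subt.
by rewrite -collision_after// -EFinN/= opprB.
Qed.

(** Domination makes [Q] integrable along every characteristic, so only the mild equation remains to
    be checked. *)
Lemma boltzmann_solutionP : boltzmann_solution f <->
  forall x xi t, (0 <= t)%R ->
    f (x + t *: xi)%R xi t = (f x xi 0 + collision_upto f x xi t)%R.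
Proof.
split=> [[_ fB] x xi t t0|fB].
  by have [_] := fB x xi t t0; rewrite -collision_uptoE -EFinD => -[].
split=> // x xi t t0; split; first exact: iQ.
by rewrite -collision_uptoE -EFinD fB.
Qed.

Lemma weighted_sup_le (F : 'rV[R]_n -> 'rV[R]_n -> \bar R) (M : \bar R) :
  (forall x xi, F x xi <= (lambda x xi 0)%:E * M) -> weighted_sup lambda F <= M.
Proof.
move=> FM; apply: ge_ereal_sup => _ [[x xi] _ <-] /=.
by rewrite lee_pdivrMl ?lambda_gt0.
Qed.

Lemma observer_norm_ge0 (F : 'rV[R]_n -> 'rV[R]_n -> \bar R) :
  0 <= observer_norm lambda F.
Proof. by apply: weighted_sup_ge0 => // x xi. Qed.

Hypothesis tail0 : scattering_tail lambda z @[z --> +oo%R] --> 0.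

Let A_tail_cvg0 : (A ^+ 2)%:E * scattering_tail lambda z @[z --> +oo%R] --> 0.
Proof. by rewrite -(mule0 (A ^+ 2)%:E); exact: cvgeZl. Qed.

(** The initial norm is at most A, and both conditions on the tails of |Q| follow from the bound by
    A^2 times the tail of the frame. *)
Lemma boltzmann_uniform_scattering : boltzmann_solution f ->
  uniform_scattering_solution lambda f.
Proof.
move=> fB.
have tailQ_le z : (0 <= z)%R -> observer_norm lambda
    (tail_integral (fun x xi t => `|Q f f x xi t|) z) <=
    (A ^+ 2)%:E * scattering_tail lambda z.
  move=> z0; apply: weighted_sup_le => x xi; rewrite gee0_abs; last first.
    by apply: integral_ge0 => s _; exact: abse_ge0.
  by rewrite muleCA; exact: (tail_integral_abs_Q_le lambda_transport lambda_gt0).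
split=> //.
- apply: (@le_lt_trans _ _ (A%:E + (A ^+ 2)%:E * scattering_tail lambda 0)).
    apply: leeD; last exact: tailQ_le.
    apply: weighted_sup_le => x xi; rewrite abse_EFin -EFinM lee_fin mulrC.
    exact: fA.
  by rewrite tailK -EFinM -EFinD ltry.
- apply: squeeze_cvge (cvg_cst _) A_tail_cvg0.
  near=> z; rewrite observer_norm_ge0/= tailQ_le//; near: z.
Unshelve. all: by end_near. Qed.

(** The scattering state is forced to be the initial value plus all collisions along the
    characteristic. This gives its uniqueness and links the two fixed-point problems. *)
Lemma boltzmann_scattersP g : boltzmann_solution f ->
  scatters_uniformly_to lambda f g <->
  forall x xi, (g x xi 0 = f x xi 0 + total_collision f x xi)%R.
Proof.
move=> /boltzmann_solutionP fB; split=> [fg x xi|gE].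
  apply/eqP; rewrite -subr_eq0 -normr_le0 -lee_fin.
  (* At fixed (x, xi) the defect does not depend on t, yet it is at most this sum of the scattering
     error and the remaining collisions, which tends to 0. *)
  have lim0 : (lambda x xi 0)%:E * observer_norm lambda (fun y eta =>
        (f (y + t *: eta)%R eta t - g y eta 0)%:E) +
      (lambda x xi 0)%:E * ((A ^+ 2)%:E * scattering_tail lambda t)
      @[t --> +oo%R] --> 0.
    rewrite -[0]adde0; apply: cvgeD => //.
      by rewrite -(mule0 (lambda x xi 0)%:E); exact: cvgeZl.
    by rewrite -(mule0 (lambda x xi 0)%:E); exact: cvgeZl.
  apply: (cvge_to_ge lim0); near=> t; have t0 : (0 <= t)%R.
    by near: t; exact: nbhs_pinfty_ge.
  apply: le_trans (leeD (le_weighted_sup lambda_gt0 _ x xi)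
    (collision_after_le x xi t0)).
  rewrite abse_EFin -EFinD lee_fin fB//.
  have -> : (g x xi 0 - (f x xi 0 + total_collision f x xi) =
    - (f x xi 0 + collision_upto f x xi t - g x xi 0) -
    (total_collision f x xi - collision_upto f x xi t))%R by ring.
  by rewrite (le_trans (ler_normB _ _))// normrN.
(* Conversely, the scattering error equals in absolute value the collisions remaining after t. *)
apply: squeeze_cvge (cvg_cst _) A_tail_cvg0.
near=> t; have t0 : (0 <= t)%R by near: t; exact: nbhs_pinfty_ge.
rewrite observer_norm_ge0/=; apply: weighted_sup_le => x xi.
apply: le_trans (collision_after_le x xi t0).
rewrite abse_EFin lee_fin fB// gE -normrN.
by rewrite le_eqVlt; apply/orP; left; apply/eqP; congr `|_|%R; ring.
Unshelve. all: by end_near. Qed.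

End dominated.
End frame.
End mild_solutions.

(** * Well-posedness from initial data and from scattering states *)

Lemma linear_transport_ext (R : realType) (n : nat) (f g : phase_fun R n) :
  linear_transport_solution f -> linear_transport_solution g ->
  (forall x xi, f x xi 0 = g x xi 0) ->
  forall x xi t, 0 <= t -> f x xi t = g x xi t.
Proof.
move=> [_ fT] [_ gT] fg x xi t t0.
by rewrite -(subrK (t *: xi) x) fT// gT.
Qed.

Theorem corollary4p1p1 (R : realType) (n : nat) (lambda : phase_fun R n)
    (alpha N : R)
    (lambda_frame : uniform_scattering_frame lambda)
    (lambda_radius : isotropic_radius lambda alpha)
    (N_gt0 : 0 < N) (N_lt_alpha : N < alpha) :
  (forall f0 : 'rV[R]_n -> 'rV[R]_n -> R,
     finite_mass_energy_momentum f0 ->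
     scattering_space lambda (2^-1 * N) (free_flow f0) ->
     exists f : phase_fun R n,
       unique_phase_fun (fun g =>
         [/\ uniform_scattering_solution lambda g,
             scattering_space lambda N g &
             forall x xi, g x xi 0 = f0 x xi]) f /\
       exists finf : phase_fun R n,
         unique_phase_fun (fun g =>
           [/\ linear_transport_solution g,
               scattering_space lambda N g &
               scatters_uniformly_to lambda f g]) finf) /\
  (forall finf : phase_fun R n,
     linear_transport_solution finf ->
     scattering_space lambda (2^-1 * N) finf ->
     exists uinf : phase_fun R n,
       unique_phase_fun (fun g =>
         [/\ uniform_scattering_solution lambda g,
             scattering_space lambda N g &
             scatters_uniformly_to lambda g finf]) uinf).
Proof.
have [lambda_transport lambda_gt0 _ tail0] := lambda_frame.
have [K_gt0 /esym tailK] := lambda_radius; set K := (2 * alpha)^-1 in K_gt0 tailK.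
have alpha_gt0 : 0 < alpha by exact: lt_trans N_lt_alpha.
(* Since K = 1 / (2 alpha), the ratio is N / alpha. *)
have contractive : 2 * N * K < 1.
  have -> : 2 * N * K = N / alpha by rewrite /K; field; exact: lt0r_neq0.
  by rewrite ltr_pdivrMr// mul1r.
have spaceP A f := @scattering_spaceP R n lambda A f lambda_gt0.
have halfN : 2^-1 * N = N / 2 by rewrite mulrC.
have existence := picard_fixed_point_exists lambda_transport lambda_gt0 tailK.
have uniqueness := picard_fixed_point_unique lambda_transport lambda_gt0 tailK.
have boltzP := boltzmann_solutionP lambda_transport lambda_gt0 tailK.
have scatP := boltzmann_scattersP lambda_transport lambda_gt0 tailK.
have unifP := boltzmann_uniform_scattering lambda_transport lambda_gt0 tailK.
have afterE := picard_after lambda_transport lambda_gt0 tailK.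
split=> [f0 [if0 _ _] /spaceP f0N|finf finf_transport /spaceP finfN].
- have mf0 : measurable_fun setT (fun p => f0 p.1 p.2).
    by apply/measurable_EFinP; exact: (measurable_int _ if0).
  have f0_le x xi : `|f0 x xi| <= N / 2 * lambda x xi 0.
    have := f0N x xi 0 (lexx 0).
    by rewrite /free_flow scale0r subr0 halfN.
  have [f [mf fN fE]] := existence N _ _ measurable_before_kernel
    normr_before_kernel mf0 K_gt0 N_gt0 contractive f0_le.
  have f_char x xi t : 0 <= t ->
      f (x + t *: xi) xi t = f0 x xi + collision_upto f x xi t.
    by move=> t0; rewrite fE// picard_before.
  have f_init x xi : f x xi 0 = f0 x xi.
    have := f_char x xi 0 (lexx 0).
    by rewrite scale0r addr0 collision_upto0 addr0.
  have fB : boltzmann_solution f.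
    by apply/(boltzP f N mf fN) => x xi t t0; rewrite f_char// f_init.
  exists f; split.
    split; first by split; [exact: (unifP f N)|exact/spaceP|].
    (* A competitor satisfies the mild equation with the same datum, hence is a fixed point of the
       same operator in the same ball. *)
    move=> g [[gB _ _] /spaceP gN g_init]; have [mg _] := gB.
    apply: (uniqueness N before_kernel f0 measurable_before_kernel
      normr_before_kernel K_gt0 N_gt0 contractive g f mg mf gN fN _ fE).
    move=> x xi t t0; have := (boltzP g N mg gN).1 gB (x - t *: xi) xi t t0.
    by rewrite g_init -picard_before subrK.
  (* With the constant kernel 1 the Picard operator adds all collisions to [f0] and transports the
     result freely, so the scattering state gets its measurability and its bound N from the Picard
     estimates. *)
  pose one_kernel (_ _ : R) : R := 1.
  have m1 : measurable_fun [set: measurableTypeR R * measurableTypeR R]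
    (fun p : measurableTypeR R * measurableTypeR R => one_kernel p.1 p.2).
    exact: measurable_cst.
  have n1 t s : `|one_kernel t s| <= 1 by rewrite normr1.
  pose finf := picard one_kernel f0 f.
  have finf_char x xi t : finf (x + t *: xi) xi t = f0 x xi + total_collision f x xi.
    by rewrite /finf picard_char kernel_integral_cst1.
  have finf0 x xi : finf x xi 0 = f0 x xi + total_collision f x xi.
    by rewrite -(finf_char x xi 0) scale0r addr0.
  have finf_transport : linear_transport_solution finf.
    split=> [|x xi t _]; first exact: measurable_phase_fun_picard.
    by rewrite finf_char finf0.
  exists finf; split.
    split=> //.
      apply/spaceP; exact: (dominated_picard_ball lambda_transport lambda_gt0 tailK).
    by apply/(scatP f N) => // x xi; rewrite finf0 f_init.
  (* Scattering fixes the values at time 0, and free transport propagates them. *)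
  move=> g [g_transport _ /(scatP f N mf fN tail0 g fB) g0].
  apply: linear_transport_ext => // x xi.
  by rewrite g0 finf0 f_init.
- have minf : measurable_fun setT (fun p => finf p.1 p.2 0).
    case: finf_transport => minf _.
    apply: (@measurable_phase_fun_comp _ _ _ _ _ _ fst snd (fun=> 0) minf) => //.
  have finf_le x xi : `|finf x xi 0| <= N / 2 * lambda x xi 0.
    by rewrite -halfN; exact: finfN.
  have [f [mf fN fE]] := existence N _ _ measurable_after_kernel
    normr_after_kernel minf K_gt0 N_gt0 contractive finf_le.
  have f_char x xi t : 0 <= t -> f (x + t *: xi) xi t =
      finf x xi 0 + (collision_upto f x xi t - total_collision f x xi).
    by move=> t0; rewrite fE// (afterE f N).
  (* This identifies the initial value of the solution; substituting it into [f_char] cancels the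
     total collision term and leaves the mild equation. *)
  have f_init x xi : f x xi 0 = finf x xi 0 - total_collision f x xi.
    have := f_char x xi 0 (lexx 0).
    by rewrite scale0r addr0 collision_upto0 add0r.
  have fB : boltzmann_solution f.
    by apply/(boltzP f N mf fN) => x xi t t0; rewrite f_char// f_init; ring.
  exists f; split.
    split; [exact: (unifP f N)|exact/spaceP|].
    by apply/(scatP f N) => // x xi; rewrite f_init subrK.
  move=> g [[gB _ _] /spaceP gN gfinf]; have [mg _] := gB.
  apply: (uniqueness N after_kernel (fun x xi => finf x xi 0)
    measurable_after_kernel normr_after_kernel K_gt0 N_gt0 contractive
    g f mg mf gN fN _ fE).
  (* Scattering to [finf] expresses [finf] through the initial value of [g], which turns the mild
     equation into the fixed-point equation for [after_kernel]. *)
  move=> x xi t t0; rewrite -(subrK (t *: xi) x) (afterE g N mg gN)//.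
  rewrite ((scatP g N mg gN tail0 finf gB).1 gfinf).
  by rewrite ((boltzP g N mg gN).1 gB)//; ring.
Qed.
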